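(* Let $K$ denote the Markov kernel of Kac's random walk on the $(n-1)$-sphere $S^{n-1}\subset\mathbb{R}^n$, let $U$ denote the uniform distribution on $S^{n-1}$, and let $\delta_{e_1}$ denote the probability measure concentrated at the point $e_1=(1,0,\ldots,0)\in\mathbb{R}^n$. Then $$\|\delta_{e_1} K^t - U\|_{\mathrm{TV}} \le \varepsilon$$ for $t > c\, n^5 (\log n)^3 \log \varepsilon^{-1}$, where $c$ is a constant that does not depend on $n$.
   Context: Kac's random walk on $S^{n-1}=\{x\in\mathbb{R}^n:\sum_i x_i^2=1\}$ is the discrete-time Markov chain which at each step chooses a pair $\{i,j\}$ of distinct coordinates uniformly among the $\binom n2$ pairs, chooses an angle $\theta$ uniformly in $[0,2\pi)$, and moves from $x$ to $R(i,j;\theta)x$, where $R(i,j;\theta)\in SO(n)$ is the rotation by angle $\theta$ in the oriented $(x_i,x_j)$ coordinate plane (fixing all other coordinates). Its kernel acts on continuous functions $f:S^{n-1}\to\mathbb{R}$ by $$(Kf)(x)=\frac{1}{\binom n2}\sum_{1\le i<j\le n}\int_0^{2\pi} f(R(i,j;\theta)x)\,\frac{1}{2\pi}\,d\theta,$$ and on probability measures by $(\mu K)(f)=\mu(Kf)$; thus $\delta_{e_1}K^t$ is the law after $t$ steps of the walk started at $e_1$. The total variation distance is normalized as $\|\mu-\nu\|_{\mathrm{TV}}=2\sup_A|\mu(A)-\nu(A)|$, the supremum being over measurable sets $A$; equivalently $\sup_{\|f\|_\infty\le 1}|\mu(f)-\nu(f)|$.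
   Formalization: The formal claim takes n ≥ 2 and 0 < ε ≤ ε₀ < 1, with c independent of n, ε and t but allowed to depend on ε₀; a single c for all ε < 1 is impossible, since for n = 3 and t = 1 the distance is 2 while the threshold tends to 0 as ε → 1. *)

(* Defs.v *)
From HB Require Import structures.
From mathcomp Require Import all_boot all_order all_algebra.
From mathcomp Require Import all_classical all_reals all_analysis.
From mathcomp Require Import measurable_realfun ring.

Set Implicit Arguments.
Unset Strict Implicit.
Unset Printing Implicit Defensive.
Import Order.TTheory GRing.Theory Num.Theory.
Import numFieldNormedType.Exports.

Local Open Scope classical_set_scope.
Local Open Scope ring_scope.

Definition coord_pair (n : nat) : Type := {p : 'I_n * 'I_n | (p.1 < p.2)%N}.
HB.instance Definition _ n := Finite.on (coord_pair n).

Lemma card_coord_pair n : #|{: coord_pair n}| = 'C(n, 2).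
Proof.
rewrite card_sig -sum1_card.
rewrite (eq_bigl (fun p : 'I_n * 'I_n => predT p.1 && (p.1 < p.2)%N)); last first.
  by move=> p; rewrite inE.
rewrite -(pair_big_dep predT (fun i j : 'I_n => (i < j)%N) (fun _ _ => 1%N)) /=.
rewrite (exchange_big_dep predT) //= -bin2_sum big_mkord.
apply: eq_bigr => j _.
rewrite -(big_ord_widen n (fun=> 1%N) (ltnW (ltn_ord j))).
by rewrite sum1_card card_ord.
Qed.

Section special_orthogonal.
Context (R : realType) (n : nat).

Definition special_orthogonal : pred 'M[R]_n :=
  [pred A | (A *m A^T == 1%:M) && (\det A == 1)].

Definition SO : Type := {A : 'M[R]_n | special_orthogonal A}.

Section plane_rotation.
Variable p : coord_pair n.
Let i := (val p).1.
Let j := (val p).2.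

(* e_i |-> cos t e_i + sin t e_j,  e_j |-> - sin t e_i + cos t e_j *)
Definition rot_mx (t : R) : 'M[R]_n :=
  1%:M + (cos t - 1) *: (delta_mx i i + delta_mx j j)
       + sin t *: (delta_mx j i - delta_mx i j).

Let P : 'M[R]_n := delta_mx i i + delta_mx j j.
Let J : 'M[R]_n := delta_mx j i - delta_mx i j.

Let ij : (i == j) = false.
Proof. by apply/negbTE; rewrite -val_eqE /= neq_ltn (valP p). Qed.
Let ji : (j == i) = false. Proof. by rewrite eq_sym ij. Qed.

Let mulPP : P *m P = P.
Proof.
by rewrite /P mulmxDl !mulmxDr !mul_delta_mx_cond !eqxx ij ji !mulr0n
  !mulr1n addr0 add0r.
Qed.

Let mulPJ : P *m J = J.
Proof.
by rewrite /P /J mulmxDl !mulmxBr !mul_delta_mx_cond !eqxx ij ji !mulr0n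
  !mulr1n sub0r subr0 addrC.
Qed.

Let mulJP : J *m P = J.
Proof.
by rewrite /P /J mulmxBl !mulmxDr !mul_delta_mx_cond !eqxx ij ji !mulr0n
  !mulr1n add0r addr0.
Qed.

Let mulJJ : J *m J = - P.
Proof.
by rewrite /P /J mulmxBl !mulmxBr !mul_delta_mx_cond !eqxx ij ji !mulr0n
  !mulr1n sub0r subr0 opprD addrC.
Qed.

Lemma rot_mxD s t : rot_mx (s + t) = rot_mx s *m rot_mx t.
Proof.
rewrite /rot_mx -/P -/J cosD sinD.
rewrite !mulmxDl !mulmxDr !mul1mx !mulmx1 -!scalemxAl -!scalemxAr.
rewrite mulPP mulPJ mulJP mulJJ.
apply/matrixP => k l; move: P J => P' J'; rewrite !mxE; ring.
Qed.

Lemma rot_mx0 : rot_mx 0 = 1%:M.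
Proof. by rewrite /rot_mx cos0 sin0 subrr !scale0r !addr0. Qed.

Lemma rot_mx_tr t : (rot_mx t)^T = rot_mx (- t).
Proof.
apply/matrixP => k l; rewrite !mxE cosN sinN (eq_sym l k).
rewrite ![(l == _) && _]andbC; ring.
Qed.

Lemma rot_mx_SO t : special_orthogonal (rot_mx t).
Proof.
have o s : rot_mx s *m (rot_mx s)^T = 1%:M.
  by rewrite rot_mx_tr -rot_mxD subrr rot_mx0.
apply/andP; split; first exact/eqP.
have -> : t = t / 2 + t / 2 by rewrite -splitr.
by rewrite rot_mxD det_mulmx -{2}det_tr -det_mulmx o det1.
Qed.

Definition rot (t : R) : SO := exist _ (rot_mx t) (rot_mx_SO t).

End plane_rotation.
End special_orthogonal.

Definition sphere_display : measure_display. Proof. exact. Qed.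

(* The hypothesis 1 < n is a parameter of the type because measurable types
   must be inhabited. *)
Definition sphere (R : realType) (n : nat) (n2 : (1 < n)%N) : Type :=
  {x : 'cV[R]_n | \sum_i x i 0 ^+ 2 == 1}.
Arguments sphere R {n} n2.

Section sphere.
Context (R : realType) (n : nat) (n2 : (1 < n)%N).
Local Notation sphere := (sphere R n2).

Lemma e1_subproof :
  \sum_i (delta_mx (Ordinal (ltnW n2)) 0 : 'cV[R]_n) i 0 ^+ 2 == 1.
Proof.
rewrite (bigD1 (Ordinal (ltnW n2))) //= mxE !eqxx expr1n big1 ?addr0 // => k k0.
by rewrite mxE (negbTE k0) expr0n.
Qed.

Definition e1 : sphere := exist _ (delta_mx (Ordinal (ltnW n2)) 0) e1_subproof.

HB.instance Definition _ := gen_eqMixin sphere.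
HB.instance Definition _ := gen_choiceMixin sphere.
HB.instance Definition _ := isPointed.Build sphere e1.

Definition sphere_coord (i : 'I_n) (x : sphere) : R := val x i 0.

(* The sigma-algebra generated by the coordinate functions is the Borel
   sigma-algebra of the sphere. *)
Definition sphere_measurable : set (set sphere) := g_sigma_preimage sphere_coord.

Let sphere_measurable0 : sphere_measurable set0.
Proof. exact: sigma_algebra0. Qed.

Let sphere_measurableC A : sphere_measurable A -> sphere_measurable (~` A).
Proof. exact: sigma_algebraC. Qed.

Let sphere_measurable_bigcup (F : (set sphere)^nat) :
  (forall i, sphere_measurable (F i)) -> sphere_measurable (\bigcup_i F i).
Proof. exact: sigma_algebra_bigcup. Qed.

HB.instance Definition _ := @isMeasurable.Build sphere_display sphere
  sphere_measurable sphere_measurable0 sphere_measurableC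
  sphere_measurable_bigcup.

Lemma measurable_sphere_coord i : measurable_fun [set: sphere] (sphere_coord i).
Proof.
move=> _ Y mY; rewrite setTI; apply: sub_sigma_algebra => /=.
rewrite -bigcup_seq/=; exists i => /=; first by rewrite mem_index_enum.
by exists Y => //; rewrite setTI.
Qed.

Lemma measurable_fun_sphere_coordP d (T : measurableType d) (f : T -> sphere) :
  (forall i, measurable_fun [set: T] (sphere_coord i \o f)) ->
  measurable_fun [set: T] f.
Proof.
move=> mf _ A mA; rewrite setTI.
have : preimage_set_system [set: T] f sphere_measurable (f @^-1` A).
  by exists A => //; rewrite setTI.
rewrite /sphere_measurable -g_sigma_preimage_comp.
apply: smallest_sub; first exact: sigma_algebra_measurable.
rewrite -bigcup_seq /=; apply: bigcup_sub => i _ B [C mC <-].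
exact: mf.
Qed.

Lemma rotate_subproof (A : SO R n) (x : sphere) :
  \sum_i (val A *m val x) i 0 ^+ 2 == 1.
Proof.
have E (y : 'cV[R]_n) : \sum_i y i 0 ^+ 2 = (y^T *m y) 0 0.
  by rewrite mxE; apply: eq_bigr => i _; rewrite mxE expr2.
case: A => A /= /andP[/eqP /mulmx1C AA _].
rewrite E trmx_mul mulmxA -(mulmxA _ A^T) AA mulmx1 -E.
exact: valP x.
Qed.

Definition rotate (A : SO R n) (x : sphere) : sphere :=
  exist _ (val A *m val x) (rotate_subproof A x).

(* SO(n) is compact and acts transitively on the sphere (n >= 2), so there is
   exactly one invariant probability measure: normalized surface measure. *)
Definition is_uniform (U : probability sphere R) : Prop :=
  forall (A : SO R n) (B : set sphere), measurable B -> U (rotate A @^-1` B) = U B.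

Lemma measurable_rotate_rot (p : coord_pair n) :
  measurable_fun [set: sphere * R] (fun z => rotate (rot p z.2) z.1).
Proof.
apply: measurable_fun_sphere_coordP => i.
rewrite [X in measurable_fun _ X](_ : _ = fun z : sphere * R =>
    \sum_k rot_mx p z.2 i k * sphere_coord k z.1); last first.
  by apply/funext => z; rewrite /sphere_coord /= mxE.
apply: measurable_sum => k; apply: measurable_funM; last first.
  by apply: measurableT_comp; [exact: measurable_sphere_coord|exact: measurable_fst].
rewrite /rot_mx; under eq_fun do rewrite !mxE.
apply: measurable_funD; [apply: measurable_funD => //|]; apply: measurable_funM => //.
- apply: measurable_funB => //; apply: measurableT_comp; last exact: measurable_snd.
  by apply: continuous_measurable_fun; exact: continuous_cos.
- apply: measurableT_comp; last exact: measurable_snd.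
  by apply: continuous_measurable_fun; exact: continuous_sin.
Qed.

Lemma measurable_rotate_rot1 (p : coord_pair n) (x : sphere) :
  measurable_fun [set: R] (fun t => rotate (rot p t) x).
Proof.
exact: (measurableT_comp (measurable_rotate_rot p) (pair1_measurable x)).
Qed.

Lemma twopi_gt0 : (0 : R) < 2 * pi.
Proof. by rewrite mulr_gt0 // pi_gt0. Qed.

Local Open Scope ereal_scope.

(* K(x, A), i.e. (Kf)(x) for f the indicator function of A. *)
Definition kac_prob (x : sphere) (A : set sphere) : \bar R :=
  ('C(n, 2)%:R^-1)%:E *
  \sum_(p : coord_pair n)
    uniform_prob twopi_gt0 [set t | A (rotate (rot p t) x)].

Let kac0 x : kac_prob x set0 = 0.
Proof. by rewrite /kac_prob big1 ?mule0 // => p _; rewrite measure0. Qed.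

Let kac_ge0 x A : 0 <= kac_prob x A.
Proof. by rewrite mule_ge0 ?lee_fin ?invr_ge0 // sume_ge0. Qed.

Let kac_additive x : semi_sigma_additive (kac_prob x).
Proof.
move=> F mF tF mUF; rewrite /kac_prob.
rewrite [X in X @ _](_ : _ = fun m => ('C(n, 2)%:R^-1)%:E *
    \sum_(p : coord_pair n) \sum_(0 <= k < m)
      uniform_prob twopi_gt0 [set t | F k (rotate (rot p t) x)]); last first.
  apply/funext => m; rewrite exchange_big ge0_sume_distrr // => k _.
  by rewrite sume_ge0.
apply: cvgeZl => //; apply: cvg_nnesum => p _.
  by apply: nearW => m; rewrite sume_ge0.
rewrite (_ : [set t | _] = (fun t => rotate (rot p t) x) @^-1` (\bigcup_k F k))//.
rewrite preimage_bigcup; apply: measure_semi_sigma_additive.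
- by move=> k; rewrite -[X in measurable X]setTI; exact: measurable_rotate_rot1.
- by apply/trivIsetP => a b _ _ ab; rewrite -preimage_setI;
    move/trivIsetP : tF => -> //; rewrite preimage_set0.
- rewrite -preimage_bigcup -[X in measurable X]setTI.
  exact: measurable_rotate_rot1.
Qed.

HB.instance Definition _ x := isMeasure.Build _ _ _ (kac_prob x)
  (kac0 x) (kac_ge0 x) (@kac_additive x).

Definition kac : sphere -> {measure set sphere -> \bar R} := kac_prob.

Let measurable_kac A : measurable A -> measurable_fun [set: sphere] (kac ^~ A).
Proof.
move=> mA; apply: measurable_funeM; apply: emeasurable_sum => p.
have mB : measurable ((fun z : sphere * R => rotate (rot p z.2) z.1) @^-1` A).
  by rewrite -[X in measurable X]setTI; exact: measurable_rotate_rot.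
have := measurable_fun_xsection (uniform_prob twopi_gt0) mB.
by congr (measurable_fun _ _); apply/funext => x /=; congr (uniform_prob _ _);
  apply/seteqP; split => t /=; rewrite /xsection /= inE.
Qed.

HB.instance Definition _ := @isKernel.Build _ _ _ _ _ kac measurable_kac.

Let kac_setT x : kac x [set: sphere] = 1.
Proof.
rewrite /= /kac_prob (eq_bigr (fun=> 1)) => [|p _]; last first.
  exact: (probability_setT (uniform_prob twopi_gt0)).
rewrite sumEFin sumr_const card_coord_pair -EFinM mulVf //.
by rewrite pnatr_eq0 -lt0n bin_gt0.
Qed.

HB.instance Definition _ := @Kernel_isProbability.Build _ _ _ _ _ kac kac_setT.

End sphere.

Arguments e1 R {n} n2.
Arguments kac R {n} n2 x : rename.

Section markov.
Context d (T : measurableType d) (R : realType).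
Local Open Scope ereal_scope.

Section kstep.
Variables (mu : probability T R) (K : R.-pker T ~> T).

(* mu K *)
Definition kstep (A : set T) : \bar R := \int[mu]_x K x A.

Let step0 : kstep set0 = 0.
Proof. by apply: integral0_eq => x _; rewrite measure0. Qed.

Let step_ge0 A : 0 <= kstep A.
Proof. exact: integral_ge0. Qed.

Let step_additive : semi_sigma_additive kstep.
Proof.
move=> F mF tF mUF.
rewrite (_ : (fun m => _) = fun m => \int[mu]_x \sum_(0 <= k < m) K x (F k)).
  rewrite [X in _ --> X](_ : _ = \int[mu]_x (limn (fun m => \sum_(0 <= k < m) K x (F k)))).
    apply: cvg_monotone_convergence => //.
    - move=> m; apply: emeasurable_sum => k; exact: measurable_kernel.
    - by move=> m x _; rewrite sume_ge0.
    - by move=> x _ a b ab; apply: lee_sum_nneg_natr.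
  apply: eq_integral => x _; apply/esym/cvg_lim => //.
  exact: measure_semi_sigma_additive.
apply/funext => m; rewrite ge0_integral_sum // => k.
exact: measurable_kernel.
Qed.

HB.instance Definition _ := isMeasure.Build _ _ _ kstep
  step0 step_ge0 step_additive.

Let step_setT : kstep setT = 1.
Proof.
rewrite /kstep; under eq_integral do rewrite prob_kernel.
rewrite integral_cst // mul1e; exact: (probability_setT mu).
Qed.

HB.instance Definition _ := Measure_isProbability.Build _ _ _ kstep step_setT.

End kstep.

(* mu K^t *)
Definition law (mu : probability T R) (K : R.-pker T ~> T) (t : nat) :
  probability T R := iter t (fun nu : probability T R => kstep nu K) mu.

(* Normalized so that mutually singular measures are at distance 2. *)
Definition tv_dist (mu nu : probability T R) : \bar R :=
  2%:E * ereal_sup [set `|mu A - nu A| | A in measurable].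

End markov.

(* Main.v *)
Require Import Defs.
From mathcomp Require Import all_boot all_order all_algebra.
From mathcomp Require Import all_classical all_reals all_analysis.
From mathcomp Require Import measurable_realfun ring lra.

(** The walk started at a point is coupled with a stationary walk, and the
    coupled walks are shown to meet.  No coupling is built as a measure.  Write
    [K f] for [kac_mean f], so that the law of the walk is recovered from the
    iterates of [K] by duality ([mean_law]).  Coupling one step of the walks
    at [x] and [y] means changing the variable in the circle integral at [y],
    and a coupling argument becomes a proof by induction on [t] of an
    inequality [K^t f(x) <= K^t f(y) + error(x, y)].  Integrating it over [y]
    against the uniform law [U], which is stationary, bounds
    [K^t f(x) - U(f)].

    In the first phase both walks select the same plane and end on the same
    ray of it.  Writing [d_k = x_k^2 - y_k^2], the selection of the plane
    [(i, j)] replaces [d_i, d_j] by [(d_i + d_j) cos^2] and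
    [(d_i + d_j) sin^2] of one common angle.  Since the mean of
    [cos^4 + sin^4] is [3/4] and the [d_k] add up to [0], the expected sum of
    the [d_k^2] shrinks by the factor [1 - 1/(2n)] or better
    ([kac_mean_iter_contract]).

    In the second phase the [d_k] are already tiny, and the walks are made to
    agree exactly, one coordinate after the other.  In the selected plane the
    two points lie on circles of radii [r] and [r'], and the angles are coupled
    so that the first coordinates coincide while the second ones have the same
    sign.  Carrying the smaller circle to the larger one in this way contracts
    angles, so the coupling fails only with a probability of order
    [sqrt (|r^2 - r'^2|) / max r r'] ([circle_mean_projection]).  The whole
    discrepancy [d_i + d_j] is moved to the second coordinate, hence the sum of
    the [|d_k|] does not grow; the number of coordinates in which the points
    differ does not grow either, and it drops when two differing coordinates
    are selected together.  When one differing coordinate is left, its [d_k]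
    is the sum of all of them, which is [0], and it disappears as soon as it is
    selected.  So some plane always lowers the count ([exists_merging]) and the
    walks meet after about [n^3] steps ([kac_mean_iter_coalesce]).

    A step of the second phase is cheap only if the stationary point is not
    too close to the axis of the selected plane.  Small coordinates are
    unlikely under [U]: some coordinate has square at least [1/n], and the
    rotations in the plane spanned by it and a small coordinate preserve [U] and
    rarely leave that coordinate small ([uniform_axis_risk]).  The two phases and this estimate give
    [kac_tv_dist].  A time of order [n^3 (1 + ln (1/eps))] makes its error
    small, and the theorem allows more. *)

Set Implicit Arguments.
Unset Strict Implicit.
Unset Printing Implicit Defensive.
Import Order.TTheory GRing.Theory Num.Theory.
Import numFieldNormedType.Exports.
Local Open Scope classical_set_scope.
Local Open Scope ring_scope.

(** * Means of bounded measurable functions *)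

Section bounded_measurable.
Context d (T : measurableType d) (R : realType).
Implicit Types f g : T -> R.

(** All functions below are of this kind, so that their means are real numbers and
    depend linearly on them. *)
Definition bounded_measurable f :=
  measurable_fun [set: T] f /\ exists M, forall x, `|f x| <= M.

Lemma bounded_measurable_cst c : bounded_measurable (fun=> c).
Proof. by split; [exact: measurable_cst|exists `|c|]. Qed.

Lemma bounded_measurableD f g : bounded_measurable f -> bounded_measurable g ->
  bounded_measurable (fun x => f x + g x).
Proof.
move=> [mf [M fM]] [mg [N gN]]; split; first exact: measurable_funD.
by exists (M + N) => x; rewrite (le_trans (ler_normD _ _))// lerD.
Qed.

Lemma bounded_measurableM f g : bounded_measurable f -> bounded_measurable g ->
  bounded_measurable (fun x => f x * g x).
Proof.
move=> [mf [M fM]] [mg [N gN]]; split; first exact: measurable_funM.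
by exists (M * N) => x; rewrite normrM ler_pM.
Qed.

Lemma bounded_measurableB f g : bounded_measurable f -> bounded_measurable g ->
  bounded_measurable (fun x => f x - g x).
Proof.
move=> [mf [M fM]] [mg [N gN]]; split; first exact: measurable_funB.
by exists (M + N) => x; rewrite (le_trans (ler_normB _ _))// lerD.
Qed.

Lemma bounded_measurable_sum (I : Type) (s : seq I) (F : I -> T -> R) :
  (forall i, bounded_measurable (F i)) ->
  bounded_measurable (fun x => \sum_(i <- s) F i x).
Proof.
move=> bF; elim: s => [|i s IH].
  by under eq_fun do rewrite big_nil; exact: bounded_measurable_cst.
by under eq_fun do rewrite big_cons; exact: bounded_measurableD.
Qed.

Lemma bounded_measurable_indic (A : set T) : measurable A ->
  bounded_measurable (\1_A : T -> R).
Proof.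
move=> mA; split; first exact: measurable_indic.
by exists 1 => x; rewrite indicE; case: (_ \in _); rewrite ?normr1 ?normr0.
Qed.

Variable mu : probability T R.

Lemma bounded_measurable_integrable f :
  bounded_measurable f -> mu.-integrable [set: T] (EFin \o f).
Proof.
move=> [mf [M fM]]; apply: measurable_bounded_integrable => //.
  by apply: (@le_lt_trans _ _ 1%E); [exact: probability_le1|exact: ltry].
exists M; split; first exact: num_real.
by move=> N MN x _ /=; rewrite (le_trans (fM x))// ltW.
Qed.

Lemma mean_EFin f : bounded_measurable f ->
  ((\int[mu]_x f x)%R%:E = \int[mu]_x (f x)%:E)%E.
Proof.
move=> bf; rewrite /Rintegral fineK//.
by apply: integrable_fin_num => //; exact: bounded_measurable_integrable.
Qed.

Lemma meanD f g : bounded_measurable f -> bounded_measurable g ->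
  \int[mu]_x (f x + g x) = \int[mu]_x f x + \int[mu]_x g x.
Proof.
by move=> bf bg; rewrite RintegralD//; exact: bounded_measurable_integrable.
Qed.

Lemma meanB f g : bounded_measurable f -> bounded_measurable g ->
  \int[mu]_x (f x - g x) = \int[mu]_x f x - \int[mu]_x g x.
Proof.
by move=> bf bg; rewrite RintegralB//; exact: bounded_measurable_integrable.
Qed.

Lemma meanZ f c : bounded_measurable f ->
  \int[mu]_x (c * f x) = c * \int[mu]_x f x.
Proof.
by move=> bf; rewrite RintegralZl//; exact: bounded_measurable_integrable.
Qed.

Lemma mean_cst c : \int[mu]_x c = c.
Proof.
have := @Rintegral_cst _ _ _ mu [set: T] measurableT c; rewrite /cst => ->.
rewrite [X in fine X](_ : _ = 1%E) ?mulr1//; exact: (probability_setT mu).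
Qed.

Lemma mean_le f g : bounded_measurable f -> bounded_measurable g ->
  (forall x, f x <= g x) -> \int[mu]_x f x <= \int[mu]_x g x.
Proof.
by move=> bf bg fg; apply: le_Rintegral => //; exact: bounded_measurable_integrable.
Qed.

Lemma mean_sum (I : Type) (s : seq I) (F : I -> T -> R) :
  (forall i, bounded_measurable (F i)) ->
  \int[mu]_x \sum_(i <- s) F i x = \sum_(i <- s) \int[mu]_x F i x.
Proof.
move=> bF; elim: s => [|i s IH].
  by rewrite big_nil; under eq_Rintegral do rewrite big_nil; exact: mean_cst.
rewrite big_cons -IH -meanD//; last exact: bounded_measurable_sum.
by apply: eq_Rintegral => x _; rewrite big_cons.
Qed.

Lemma mean_indic (A : set T) : measurable A ->
  ((\int[mu]_x \1_A x)%R%:E = mu A)%E.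
Proof.
move=> mA; rewrite mean_EFin; last exact: bounded_measurable_indic.
by rewrite integral_indic// setIT.
Qed.

End bounded_measurable.

Lemma bounded_measurable_comp d d' (T : measurableType d)
    (T' : measurableType d') (R : realType) (h : T' -> T) (f : T -> R) :
  measurable_fun [set: T'] h -> bounded_measurable f ->
  bounded_measurable (fun x => f (h x)).
Proof.
by move=> mh [mf [M fM]]; split; [exact: measurableT_comp|exists M].
Qed.


(** * Changes of variable that expand lengths *)

Section integral_contracted.
Context d (T : measurableType d) (R : realType).
Local Open Scope ereal_scope.

Lemma integral_contracted (lambda : {measure set T -> \bar R}) (D E : set T)
    (tau : T -> T) (f : T -> \bar R) :
  measurable D -> measurable E -> measurable_fun [set: T] tau ->
  (forall s, D s -> E (tau s)) ->
  (forall B, measurable B -> lambda (D `&` tau @^-1` B) <= lambda B) ->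
  measurable_fun [set: T] f -> (forall x, 0 <= f x) ->
  \int[lambda]_(x in D) f (tau x) <= \int[lambda]_(x in E) f x.
Proof.
move=> mD mE mtau DE le_lambda mf f0.
pose g := f \_ E.
have mg : measurable_fun [set: T] g.
  by apply/(measurable_restrictT _ mE); exact: measurable_funTS.
have g0 x : 0 <= g x by rewrite /g patchE; case: ifPn.
rewrite [leRHS]integral_mkcond -/g.
rewrite (eq_integral (g \o tau)); last first.
  by move=> x /set_mem Dx; rewrite /g /= patchE mem_set//; exact: DE.
rewrite (eq_measure_integral (mrestr lambda mD)); last first.
  by move=> A mA AD; rewrite /= /mrestr setIidl.
apply: (@le_trans _ _ (\int[mrestr lambda mD]_x (g \o tau) x)).
  apply: ge0_subset_integral => //; first exact: (measurableT_comp mg mtau).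
  by move=> x _; exact: g0.
rewrite -[in leLHS](preimage_setT tau) -ge0_integral_pushforward//.
apply: ge0_le_measure_integral => // S mS.
by rewrite /= /pushforward /= /mrestr setIC le_lambda.
Qed.
End integral_contracted.

Section expanding.
Context (R : realType).
Notation lambda := (@lebesgue_measure R).
Local Open Scope ereal_scope.

Lemma lebesgue_measure_le_diam (A : set R) (L : R) : (0 <= L)%R -> measurable A ->
  (forall s t, A s -> A t -> (t - s <= L)%R) -> lambda A <= L%:E.
Proof.
move=> L0 mA AL; have [->|/set0P[a Aa]] := eqVneq A set0; first by rewrite measure0.
have lbA : has_lbound A.
  exists (a - L)%R => s As; rewrite lerBlDr -lerBlDl; exact: AL.
have sub : A `<=` `[inf A, (inf A + L)%R].
  move=> s As; rewrite /= in_itv/= ge_inf//=.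
  rewrite -lerBlDr; apply: lb_le_inf; first by exists a.
  by move=> t At; rewrite lerBlDl -lerBlDr; exact: AL.
apply: (@le_trans _ _ (lambda `[inf A, (inf A + L)%R])).
  by apply: le_measure => //; rewrite inE.
rewrite lebesgue_measure_itv/= lte_fin; case: ifPn => _; last by rewrite lee_fin.
by rewrite -EFinB lee_fin addrAC subrr add0r.
Qed.

(** A cover of [B] by intervals pulls back to a cover of the preimage by sets of
    smaller diameter.  This plays the part of a change of variable formula, for
    maps that need not be differentiable. *)
Lemma lebesgue_measure_expanding (D B : set R) (tau : R -> R) :
  measurable D -> measurable B -> measurable_fun [set: R] tau ->
  (forall s t, D s -> D t -> (t - s <= `|tau t - tau s|)%R) ->
  lambda (D `&` tau @^-1` B) <= lambda B.
Proof.
move=> mD mB mtau ex.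
have mp C : measurable C -> measurable (D `&` tau @^-1` C).
  by move=> mC; apply: measurableI => //; rewrite -[X in measurable X]setTI; exact: mtau.
rewrite [leRHS]/lebesgue_measure/= /lebesgue_stieltjes_measure/= /measure_extension.
apply: le_ereal_inf_tmp => _ [A [mA BA] <-].
have mA' i : measurable (A i : set R) by apply: sub_sigma_algebra; exact: mA.
apply: (@le_trans _ _ (\sum_(k <oo) lambda (D `&` tau @^-1` (A k)))).
  apply: measure_sigma_subadditive => //=.
  - by move=> i; exact: mp.
  - exact: mp.
  - by move=> x [Dx /BA [k _ Akx]]; exists k.
apply: lee_nneseries => // i _.
have [[a b] _ Eab] := mA i; rewrite -Eab /=.
rewrite wlength_itv/= lte_fin; case: ifPn => [ab|]; last first.
  rewrite -leNgt => ba; rewrite set_itv_ge ?bnd_simp -?leNgt//.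
  by rewrite preimage_set0 setI0 measure0.
rewrite -EFinB; apply: lebesgue_measure_le_diam.
- by rewrite subr_ge0 ltW.
- by apply: mp; exact: measurable_itv.
- move=> s t [Ds]; rewrite /= in_itv/= => /andP[as_ sb] [Dt].
  rewrite in_itv/= => /andP[at_ tb].
  apply: (le_trans (ex _ _ Ds Dt)); rewrite ler_norml; apply/andP; split; lra.
Qed.

End expanding.

(** * Means over the circle *)

Section circle.
Context (R : realType).
Notation lambda := (@lebesgue_measure R).
Notation circle := (uniform_prob (twopi_gt0 R)).
Notation tau := (2 * pi : R).

Lemma circle_mean_indicM (D : set R) (f : R -> R) :
  measurable D -> D `<=` `[0, tau] ->
  bounded_measurable f -> (forall x, 0 <= f x) ->
  ((\int[circle]_x (\1_D x * f x))%:E =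
   (tau^-1)%:E * \int[lambda]_(x in D) (f x)%:E)%E.
Proof.
move=> mD D02 bf f0.
have b1 : bounded_measurable (fun x : R => \1_D x * f x).
  by apply: bounded_measurableM => //; exact: bounded_measurable_indic.
rewrite mean_EFin// integral_uniform//; last 2 first.
- by apply/measurable_EFinP; case: b1.
- by move=> x; rewrite lee_fin mulr_ge0// indicE.
rewrite subr0; congr (_ * _)%E.
rewrite [RHS]integral_mkcond [LHS]integral_mkcond; apply: eq_integral => x _.
rewrite !patchE indicE; case: (boolP (x \in D)) => xD.
  by rewrite mul1r mem_set//; apply: D02; exact: set_mem.
by rewrite mul0r; case: ifPn.
Qed.

(** The form in which changes of variable on the circle are used.  Two pieces
    are needed because a rotation wraps around, and because the map that
    compares two circles of different radii expands lengths on each half circle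
    but not across them. *)
Lemma circle_mean_expanding (D1 D2 : set R) (t1 t2 : R -> R) (s : R) (f : R -> R) :
  measurable D1 -> measurable D2 -> D1 `<=` `[0, tau] -> D2 `<=` `[0, tau] ->
  measurable_fun [set: R] t1 -> measurable_fun [set: R] t2 ->
  0 <= s <= tau ->
  (forall x, D1 x -> 0 <= t1 x <= s) -> (forall x, D2 x -> s <= t2 x <= tau) ->
  (forall x y, D1 x -> D1 y -> y - x <= `|t1 y - t1 x|) ->
  (forall x y, D2 x -> D2 y -> y - x <= `|t2 y - t2 x|) ->
  bounded_measurable f -> (forall x, 0 <= f x) ->
  \int[circle]_x (\1_D1 x * f (t1 x)) + \int[circle]_x (\1_D2 x * f (t2 x)) <=
  \int[circle]_x f x.
Proof.
move=> mD1 mD2 D1c D2c mt1 mt2 /andP[s0 s2] t1s t2s e1 e2 bf f0.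
have mf : measurable_fun [set: R] (EFin \o f).
  by apply/measurable_EFinP; case: bf.
have f0' x : (0 <= (EFin \o f) x)%E by rewrite lee_fin.
rewrite -lee_fin EFinD !circle_mean_indicM//; last 2 first.
- exact: (bounded_measurable_comp mt2).
- exact: (bounded_measurable_comp mt1).
rewrite -ge0_muleDr; [|by apply: integral_ge0 => x _; rewrite lee_fin..].
rewrite mean_EFin// integral_uniform// subr0; apply: lee_wpmul2l.
  by rewrite lee_fin invr_ge0 ltW// twopi_gt0.
have -> : `[0, tau]%classic = `[0, s]%classic `|` `]s, tau]%classic.
  apply/seteqP; split => x /=; rewrite !in_itv/=.
    by case: (leP x s) => xs /andP[-> ->]; [left|right].
  by case => /andP[]; lra.
rewrite ge0_integral_setU//; last 3 first.
- exact: (measurable_funTS mf).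
- by move=> x _; exact: f0'.
- apply/disj_setPS => x [/=]; rewrite !in_itv/= => /andP[_ xs] /andP[sx _].
  by have := le_lt_trans xs sx; rewrite ltxx.
rewrite integral_itv_obnd_cbnd; last exact: (measurable_funTS mf).
apply: leeD; apply: integral_contracted => //.
- by move=> B mB; exact: lebesgue_measure_expanding.
- by move=> B mB; exact: lebesgue_measure_expanding.
Qed.


Lemma circle_mean_le (f g : R -> R) :
  bounded_measurable f -> bounded_measurable g ->
  (forall x, 0 <= x <= tau -> f x <= g x) ->
  \int[circle]_x f x <= \int[circle]_x g x.
Proof.
move=> bf bg fg.
have [_ [M fM]] := bf; have [_ [N gN]] := bg.
pose O : set R := ~` [set` `[0, tau]].
have mO : measurable O by apply: measurableC; exact: measurable_itv.
have bO := @bounded_measurable_indic _ _ R _ mO.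
have bc := @bounded_measurable_cst _ R R (M + N).
have O0 : \int[circle]_x (\1_O x : R) = 0.
  apply/eqP; rewrite -eqe mean_indic//= /uniform_prob integral_uniform_pdf.
  by rewrite setICl integral_set0.
have -> : \int[circle]_x g x = \int[circle]_x (g x + (M + N) * \1_O x).
  rewrite meanD//; last exact: bounded_measurableM.
  by rewrite meanZ// O0 mulr0 addr0.
apply: mean_le => //.
  by apply: bounded_measurableD => //; exact: bounded_measurableM.
move=> x; rewrite indicE; case: (boolP (x \in O)) => xO.
  have := fM x; have := gN x; rewrite mulr1 !ler_norml => /andP[? ?] /andP[? ?]; lra.
rewrite mulr0 addr0; apply: fg.
by move: xO; rewrite notin_setE => /contrapT; rewrite /= in_itv.
Qed.

(** Only the inequality is proved directly; the shift by the complementary angle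
   gives the converse. *)
Lemma circle_mean_shift_le (f : R -> R) (a : R) :
  bounded_measurable f -> (forall x, 0 <= f x) -> periodic f tau ->
  0 <= a <= tau -> \int[circle]_x f (x + a) <= \int[circle]_x f x.
Proof.
move=> bf f0 fper /andP[a0 a2].
have m1 : measurable_fun [set: R] (fun x : R => x + (a - tau)).
  exact: measurable_funD.
have m2 : measurable_fun [set: R] (fun x : R => x + a) by exact: measurable_funD.
pose D1 : set R := [set` `[tau - a, tau]]; pose D2 : set R := [set` `[0, tau - a[].
have mD1 : measurable D1 by exact: measurable_itv.
have mD2 : measurable D2 by exact: measurable_itv.
have bt1 : bounded_measurable (fun x : R => f (x + (a - tau))).
  exact: (bounded_measurable_comp m1).
have bt2 : bounded_measurable (fun x : R => f (x + a)).
  exact: (bounded_measurable_comp m2).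
have b1 : bounded_measurable (fun x : R => \1_D1 x * f (x + (a - tau))).
  by apply: bounded_measurableM => //; exact: bounded_measurable_indic.
have b2 : bounded_measurable (fun x : R => \1_D2 x * f (x + a)).
  by apply: bounded_measurableM => //; exact: bounded_measurable_indic.
have := @circle_mean_expanding D1 D2 _ _ a f mD1 mD2 _ _ m1 m2.
move=> /(_ _ _ _ _ _ _ _ bf f0) H.
apply: (le_trans _ (H _ _ _ _ _ _ _)).
- rewrite -meanD//; apply: circle_mean_le => //; first exact: bounded_measurableD.
  move=> x /andP[x0 x2]; rewrite !indicE.
  have [xa|xa] := leP (tau - a) x.
    rewrite mem_set; last by rewrite /D1/= in_itv/= xa.
    rewrite mul1r -[in leLHS](subrK tau a) addrA fper lerDl mulr_ge0//.
  rewrite [x \in D2]mem_set; last by rewrite /D2/= in_itv/= x0.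
  by rewrite mul1r lerDr mulr_ge0.
- by move=> x; rewrite /D1/= !in_itv/=; lra.
- by move=> x; rewrite /D2/= !in_itv/=; lra.
- by apply/andP; split.
- by move=> x; rewrite /D1/= !in_itv/=; lra.
- by move=> x; rewrite /D2/= !in_itv/=; lra.
- by move=> x y _ _ /=; rewrite opprD addrACA subrr addr0 ler_norm.
- by move=> x y _ _ /=; rewrite opprD addrACA subrr addr0 ler_norm.
Qed.

Lemma circle_mean_shift (f : R -> R) (a : R) :
  bounded_measurable f -> periodic f tau -> 0 <= a <= tau ->
  \int[circle]_x f (x + a) = \int[circle]_x f x.
Proof.
move=> bf fper a02.
have m b : measurable_fun [set: R] (fun x : R => x + b) by exact: measurable_funD.
wlog f0 : f bf fper / forall x, 0 <= f x.
  move=> wl; have [mf [M fM]] := bf.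
  have bM := @bounded_measurable_cst _ R R M.
  have := wl (fun x => f x + M); rewrite !meanD//; last first.
    exact: (bounded_measurable_comp (m a)).
  move=> /(_ _ _ _)/addIr; apply.
  - exact: bounded_measurableD.
  - by move=> x; rewrite fper.
  - by move=> x; have := fM x; rewrite ler_norml => /andP[]; lra.
apply/eqP; rewrite eq_le circle_mean_shift_le//=.
have := @circle_mean_shift_le (fun x => f (x + a)) (tau - a).
have -> : (fun x => f (x + (tau - a) + a)) = f.
  by apply/funext => x; rewrite -addrA subrK fper.
apply.
- exact: (bounded_measurable_comp (m a)).
- by [].
- by move=> x; rewrite addrAC fper.
- by lra.
Qed.

Lemma le_of_sin_le (x u : R) : 0 <= x <= pi / 2 -> u < 1 / 2 ->
  sin x <= u -> x <= 2 * u.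
Proof.
move=> /andP[x0 x2] u2 sxu.
have [x00|xn0] := eqVneq x 0; first by move: sxu; rewrite x00 sin0; lra.
have {}x0 : 0 < x by rewrite lt_def xn0.
have cx0 : 0 <= cos x by apply: cos_ge0_pihalf; rewrite x2 andbT; have := pi_gt0 R; lra.
have sx0 : 0 <= sin x by apply: sin_ge0_pi; have := pi_gt0 R; lra.
have cx : 1 / 2 <= cos x.
  have := cos2Dsin2 x; nra.
have [c /[!in_itv]/= /andP[c0 cx' E]] := @MVT R sin cos 0 x x0
  (fun y _ => is_derive_sin y) (continuous_subspaceT (@continuous_sin R)).
have cc : cos x <= cos c.
  apply/ltW; rewrite ltr_cos// in_itv/=; have := pi_gt0 R; lra.
rewrite sin0 !subr0 in E.
have : sin x = cos c * x := E.
nra.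
Qed.

Lemma measurable_sin_small (u : R) : measurable [set t : R | `|sin t| <= u].
Proof.
have ms : measurable_fun [set: R] (fun x : R => `|sin x|).
  apply: measurableT_comp => //.
  by apply: continuous_measurable_fun; exact: continuous_sin.
rewrite (_ : [set t : R | _] = [set: R] `&` (fun x : R => `|sin x|) @^-1` `]-oo, u]).
  by apply: ms => //; exact: measurable_itv.
by rewrite setTI; apply/seteqP; split => x /=; rewrite in_itv.
Qed.

(** Near its zeros the sine has slope at least [1/2], so it is small only on
    short intervals. *)
Lemma circle_sin_small (u : R) : 0 <= u ->
  \int[circle]_x \1_[set x : R | `|sin x| <= u] x <= 2 * u.
Proof.
move=> u0.
have mA := measurable_sin_small u.
have b1 := @bounded_measurable_indic _ _ R _ mA.
have [u2|u2] := leP (1/2) u.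
  apply: (@le_trans _ _ 1); last by lra.
  rewrite -[leRHS](mean_cst circle); apply: mean_le => //; exact: bounded_measurable_cst.
pose I1 : set R := [set` `[0, 2 * u]].
pose I2 : set R := [set` `[pi - 2 * u, pi + 2 * u]].
pose I3 : set R := [set` `[tau - 2 * u, tau]].
have mI1 : measurable I1 by exact: measurable_itv.
have mI2 : measurable I2 by exact: measurable_itv.
have mI3 : measurable I3 by exact: measurable_itv.
have bA := measurableI _ _ mA (measurable_itv `[0, tau]).
have b2 := @bounded_measurable_indic _ _ R _ bA.
apply: (@le_trans _ _ (\int[circle]_x
    (\1_([set x : R | `|sin x| <= u] `&` `[0, tau]) x * 1))).
  apply: circle_mean_le => //.
    by apply: bounded_measurableM => //; exact: bounded_measurable_cst.
  by move=> x x02; rewrite mulr1 !indicE in_setI [x \in `[_, _]%classic]mem_set// andbT.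
rewrite -lee_fin circle_mean_indicM//; last exact: bounded_measurable_cst.
rewrite integral_cst// mul1e.
apply: (@le_trans _ _ ((tau^-1)%:E * (8 * u)%:E)%E); last first.
  rewrite -EFinM lee_fin ler_pdivrMl ?twopi_gt0//.
  have := pi_ge2 R; nra.
apply: lee_wpmul2l; first by rewrite lee_fin invr_ge0 ltW// twopi_gt0.
apply: (@le_trans _ _ (lambda (I1 `|` I2 `|` I3))).
  apply: le_measure; rewrite ?inE//.
    by apply: measurableU => //; exact: measurableU.
  move=> x [/= sxu]; rewrite in_itv/= => /andP[x0 x2].
  rewrite ler_norml in sxu; move: sxu => /andP[Nsu su].
  have p0 := pi_gt0 R.
  have [x1|x1] := leP x (pi / 2).
    left; left; rewrite /I1/= in_itv/= x0/=; apply: le_of_sin_le => //.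
    exact/andP.
  have [x3|x3] := leP x pi.
    left; right; rewrite /I2/= in_itv/=; apply/andP; split; last by lra.
    suff: pi - x <= 2 * u by lra.
    apply: le_of_sin_le => //; first by lra.
    by rewrite sinB sinpi cospi mul0r sub0r mulN1r opprK.
  have [x4|x4] := leP x (3 * pi / 2).
    left; right; rewrite /I2/= in_itv/=; apply/andP; split; first by lra.
    suff: x - pi <= 2 * u by lra.
    apply: le_of_sin_le => //; first by lra.
    by rewrite sinB sinpi cospi mulr0 subr0 mulrN1 lerNl.
  right; rewrite /I3/= in_itv/=; apply/andP; split; last by lra.
  suff: tau - x <= 2 * u by lra.
  apply: le_of_sin_le => //; first by lra.
  rewrite sinB (_ : tau = pi *+ 2) ?sin2pi ?cos2pi; last by rewrite mulr_natl.
  by rewrite mul0r sub0r mul1r lerNl.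
apply: (@le_trans _ _ (lambda (I1 `|` I2) + lambda I3)%E).
  by apply: measureU2 => //; exact: measurableU.
apply: (@le_trans _ _ (lambda I1 + lambda I2 + lambda I3)%E).
  by apply: leeD => //; exact: measureU2.
rewrite /I1 /I2 /I3 !lebesgue_measure_itv/= !lte_fin.
have pi0 := pi_gt0 R.
case: ifPn => _; case: ifPn => _; case: ifPn => _; rewrite -?EFinB ?adde0 ?add0e -?EFinD lee_fin; lra.
Qed.


(** If the cosine is multiplied by [c <= 1], angles in [[0, pi]] get closer.  The
    cosine of the difference of the new angles is
    [c^2 cos a cos b + sin x sin y], where
    [sin x ^ 2 = (1 - c^2) + c^2 sin a ^ 2]; by Cauchy-Schwarz it is at least
    [(1 - c^2) + c^2 cos (b - a)], hence at least [cos (b - a)]. *)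
Lemma angle_contraction (c a b x y : R) : 0 <= c <= 1 ->
  0 <= a <= pi -> 0 <= b <= pi -> 0 <= x <= pi -> 0 <= y <= pi ->
  cos x = c * cos a -> cos y = c * cos b -> `|y - x| <= `|b - a|.
Proof.
move=> /andP[c0 c1] a0 b0 x0 y0 cx cy.
have sa := sin_ge0_pi a0; have sb := sin_ge0_pi b0.
have sx := sin_ge0_pi x0; have sy := sin_ge0_pi y0.
have sx2 : sin x ^+ 2 = (1 - c ^+ 2) + c ^+ 2 * sin a ^+ 2.
  by rewrite !sin2cos2 cx; ring.
have sy2 : sin y ^+ 2 = (1 - c ^+ 2) + c ^+ 2 * sin b ^+ 2.
  by rewrite !sin2cos2 cy; ring.
have c2 : 0 <= 1 - c ^+ 2 by nra.
have cs : 1 - c ^+ 2 + c ^+ 2 * (sin a * sin b) <= sin x * sin y.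
  rewrite -(@ler_pXn2r _ 2)// ?nnegrE ?mulr_ge0//; last first.
    by rewrite addr_ge0// !mulr_ge0.
  rewrite [leRHS]exprMn sx2 sy2 -subr_ge0.
  rewrite (_ : _ - _ = (1 - c ^+ 2) * (c ^+ 2 * (sin a - sin b) ^+ 2)); last by ring.
  by rewrite mulr_ge0// mulr_ge0 ?sqr_ge0.
have le_cos : cos `|b - a| <= cos `|y - x|.
  rewrite !cos_norm !cosB cx cy.
  have : cos a * cos b + sin a * sin b <= 1.
    by have := cos_le1 (b - a); rewrite cosB; lra.
  by move: cs; nra.
rewrite leNgt; apply/negP => lt_ab.
have := ltr_cos; move=> /(_ R `|b - a| `|y - x|); rewrite lt_ab => /(_ _ _).
rewrite !in_itv/= !normr_ge0/= !ler_norml => h.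
by move: le_cos; rewrite leNgt h//; lra.
Qed.

Lemma cos_tauB (x : R) : cos (tau - x) = cos x.
Proof. by rewrite cosB (_ : tau = pi *+ 2) ?mulr_natl// sin2pi cos2pi mul0r mul1r addr0. Qed.

Lemma sin_tauB (x : R) : sin (tau - x) = - sin x.
Proof. by rewrite sinB (_ : tau = pi *+ 2) ?mulr_natl// sin2pi cos2pi mul0r sub0r mul1r. Qed.

(** The comparison of a circle of radius [1] with a circle of radius [c]: angles
    [x] and [y] correspond when the points have the same first coordinate and
    second coordinates of the same sign.  The angles [x] without a partner are
    those with [|cos x| >= c], that is [|sin x| <= sqrt (1 - c^2)], and only the
    bound [f <= 1] is used there.  On the others the map from [x] to [y] expands
    lengths by [angle_contraction]. *)
Lemma circle_mean_projection (c w : R) (f g : R -> R) : 0 <= c <= 1 -> 0 <= w ->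
  bounded_measurable f -> bounded_measurable g ->
  (forall x, f x <= 1) -> (forall x, 0 <= g x) ->
  (forall x y, cos x = c * cos y -> 0 <= sin x * sin y -> f x <= g y + w) ->
  \int[circle]_x f x <= \int[circle]_x g x + w + 2 * Num.sqrt (1 - c ^+ 2).
Proof.
move=> /andP[c0 c1] w0 bf bg f1 g0 fg.
have [c00|cn0] := eqVneq c 0.
  rewrite c00 expr0n/= subr0 sqrtr1 mulr1.
  apply: (@le_trans _ _ (\int[circle]_x (1 : R))).
    by apply: mean_le => //; exact: bounded_measurable_cst.
  rewrite mean_cst -[leLHS]add0r lerD ?ler1n//.
  by rewrite addr_ge0//; exact: Rintegral_ge0.
have {cn0}cgt0 : 0 < c by rewrite lt_def cn0.
have pi0 := pi_gt0 R.
(* The arc cosine is continuous in the open interval, hence measurable once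
   it is extended by 0. *)
pose arc := (@acos R) \_ [set` `]-1, 1[].
have marc : measurable_fun [set: R] arc.
  have mI : measurable ([set` `]-1, 1[] : set R) by exact: measurable_itv.
  apply/(measurable_restrictT _ mI).
  apply: open_continuous_measurable_fun; first exact: interval_open.
  by move=> x; rewrite inE/= in_itv/=; exact: continuous_acos.
have mcos : measurable_fun [set: R] (fun x : R => cos x / c).
  apply: measurable_funM => //.
  by apply: continuous_measurable_fun; exact: continuous_cos.
have mt1 : measurable_fun [set: R] (fun x : R => arc (cos x / c)).
  exact: (measurableT_comp marc mcos).
have mt2 : measurable_fun [set: R] (fun x : R => tau - arc (cos x / c)).
  exact: measurable_funB.
pose G : set R := (fun x : R => cos x / c) @^-1` [set` `]-1, 1[].
have mG : measurable G.
  by rewrite -[G]setTI; apply: mcos => //; exact: measurable_itv.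
have arcE x : G x -> cos (arc (cos x / c)) = cos x / c /\ 0 <= arc (cos x / c) <= pi.
  rewrite /G/= in_itv/= => /andP[x1 x2].
  rewrite /arc patchE mem_set; last by rewrite /= in_itv/= x1 x2.
  have xx : -1 <= cos x / c <= 1 by rewrite (ltW x1) (ltW x2).
  rewrite acosK; last by rewrite in_itv.
  split => //.
  by apply/andP; split; [exact: acos_ge0|exact: acos_lepi].
have ccos x : c * (cos x / c) = cos x by rewrite mulrC divfK// gt_eqF.
pose D1 := G `&` [set` `[0, pi]]; pose D2 := G `&` [set` `]pi, tau]].
have mD1 : measurable D1 by apply: measurableI => //; exact: measurable_itv.
have mD2 : measurable D2 by apply: measurableI => //; exact: measurable_itv.
pose u := Num.sqrt (1 - c ^+ 2).
pose B : set R := [set x : R | `|sin x| <= u].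
have mB : measurable B by exact: measurable_sin_small.
have bB := @bounded_measurable_indic _ _ R _ mB.
have b1 : bounded_measurable (fun x : R => \1_D1 x * g (arc (cos x / c))).
  apply: bounded_measurableM; first exact: bounded_measurable_indic.
  exact: (bounded_measurable_comp mt1).
have b2 : bounded_measurable (fun x : R => \1_D2 x * g (tau - arc (cos x / c))).
  apply: bounded_measurableM; first exact: bounded_measurable_indic.
  exact: (bounded_measurable_comp mt2).
have bw := @bounded_measurable_cst _ R R w.
have b12 := bounded_measurableD b1 b2.
have b12w := bounded_measurableD b12 bw.
apply: (@le_trans _ _ (\int[circle]_x (\1_D1 x * g (arc (cos x / c)) +
    \1_D2 x * g (tau - arc (cos x / c)) + w + \1_B x))).
  apply: circle_mean_le => //; first exact: bounded_measurableD.
  move=> x /andP[x0 x2]; rewrite !indicE.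
  have [Gx|nGx] := pselect (G x).
    have [cx /andP[ax0 axpi]] := arcE x Gx.
    have [xp|xp] := leP x pi.
      have -> : x \in D1 by rewrite mem_set//; split => //=; rewrite in_itv/= x0.
      have -> : (x \in D2) = false.
        by apply/memNset => -[_]; rewrite /= in_itv/=; lra.
      rewrite mul1r mul0r addr0 ler_wpDr//; apply: fg; first by rewrite cx ccos.
      by rewrite mulr_ge0// sin_ge0_pi//; apply/andP.
    have -> : x \in D2 by rewrite mem_set//; split => //=; rewrite in_itv/= xp.
    have -> : (x \in D1) = false.
      by apply/memNset => -[_]; rewrite /= in_itv/=; lra.
    rewrite mul1r mul0r add0r ler_wpDr//; apply: fg; first by rewrite cos_tauB cx ccos.
    rewrite [sin (tau - arc _)]sin_tauB -[sin x]opprK -(sin_tauB x) mulrNN mulr_ge0//.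
      by rewrite sin_ge0_pi//; lra.
    by rewrite sin_ge0_pi// ax0.
  have -> : x \in B.
    rewrite mem_set// /B/= /u.
    have c2 : c ^+ 2 <= cos x ^+ 2.
      rewrite leNgt; apply/negP => cosc; apply: nGx; rewrite /G/= in_itv/= -ltr_norml.
      rewrite normrM normfV (gtr0_norm cgt0) ltr_pdivrMr// mul1r.
      rewrite -(@ltr_pXn2r _ 2)// ?nnegrE ?normr_ge0//.
      by rewrite real_normK ?num_real.
    rewrite -sqrtr_sqr ler_sqrt; last by nra.
    by rewrite sin2cos2; lra.
  have := f1 x; rewrite mulr1n.
  have : 0 <= (x \in D1)%:R * g (arc (cos x / c)) by rewrite mulr_ge0.
  have : 0 <= (x \in D2)%:R * g (tau - arc (cos x / c)) by rewrite mulr_ge0.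
  lra.
rewrite meanD// meanD// meanD// mean_cst.
apply: lerD; last by apply: circle_sin_small; exact: sqrtr_ge0.
apply: lerD => //.
apply: (@circle_mean_expanding D1 D2 _ _ pi) => //.
- by move=> x [_]; rewrite /= !in_itv/=; lra.
- by move=> x [_]; rewrite /= !in_itv/=; lra.
- by apply/andP; split; lra.
- by move=> x [/arcE[]].
- by move=> x [/arcE[_]] + _; lra.
- move=> x y [Gx xpi] [Gy ypi]; apply: (le_trans (ler_norm _)).
  have [cx ax] := arcE x Gx; have [cy ay] := arcE y Gy.
  rewrite /= in_itv/= in xpi; rewrite /= in_itv/= in ypi.
  apply: (@angle_contraction c) => //; rewrite ?c0 ?cx ?cy ?ccos//.
- move=> x y [Gx xpi] [Gy ypi]; apply: (le_trans (ler_norm _)).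
  have [cx ax] := arcE x Gx; have [cy ay] := arcE y Gy.
  rewrite /= in_itv/= in xpi; rewrite /= in_itv/= in ypi.
  have := @angle_contraction c (arc (cos x / c)) (arc (cos y / c)) (tau - x) (tau - y).
  rewrite !cos_tauB cx cy !ccos c0 c1 => /(_ isT ax ay _ _ erefl erefl) H.
  rewrite (_ : y - x = - ((tau - y) - (tau - x))); last by ring.
  rewrite (_ : tau - arc (cos y / c) - (tau - arc (cos x / c)) =
    - (arc (cos y / c) - arc (cos x / c))); last by ring.
  by rewrite !normrN; apply: H; lra.
Qed.

End circle.

(** * Rotations of the sphere *)

Section rotations.
Context (R : realType) (n : nat) (n2 : (1 < n)%N).
Notation sphere := (sphere R n2).
Notation circle := (uniform_prob (twopi_gt0 R)).
Notation tau := (2 * pi : R).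
Implicit Types (p : coord_pair n) (x y : sphere) (f : sphere -> R).

Lemma sphere_coord_inj x y :
  (forall k, sphere_coord k x = sphere_coord k y) -> x = y.
Proof.
move=> xy; apply: val_inj; apply/matrixP => k l.
by rewrite ord1; exact: xy.
Qed.

Lemma sphere_coord_sum x : \sum_k sphere_coord k x ^+ 2 = 1.
Proof. by apply/eqP; exact: (valP x). Qed.

Lemma coord_pair_neq p : (val p).1 != (val p).2.
Proof. by rewrite -val_eqE /= neq_ltn (valP p). Qed.

Definition turn p (t : R) x : sphere := rotate (Defs.rot p t) x.

Lemma turn_coord p t x k : sphere_coord k (turn p t x) =
  if k == (val p).1 then
    cos t * sphere_coord (val p).1 x - sin t * sphere_coord (val p).2 x
  else if k == (val p).2 then
    sin t * sphere_coord (val p).1 x + cos t * sphere_coord (val p).2 x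
  else sphere_coord k x.
Proof.
have ij := coord_pair_neq p.
set i := (val p).1 in ij *; set j := (val p).2 in ij *.
have D (a b : 'I_n) : (delta_mx a b *m val x) k 0 = (k == a)%:R * val x b 0.
  rewrite mxE (bigD1 b)//= mxE eqxx andbT big1 ?addr0// => c cb.
  by rewrite mxE (negbTE cb) andbF mul0r.
rewrite /sphere_coord /turn /= /rot_mx -/i -/j.
rewrite !mulmxDl -!scalemxAl mulmxDl mulmxBl mul1mx.
move: (D i i) (D j j) (D j i) (D i j).
move: (delta_mx i i *m _) (delta_mx j j *m _) (delta_mx j i *m _) (delta_mx i j *m _).
move=> A B C E hA hB hC hE; rewrite !mxE hA hB hC hE.
have [->|ki] := eqVneq k i; first by rewrite (negbTE ij) !mul0r !mul1r; ring.
by have [->|kj] := eqVneq k j; rewrite ?mul0r ?mul1r; ring.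
Qed.

Lemma turnD p s t x : turn p s (turn p t x) = turn p (s + t) x.
Proof. by apply: val_inj; rewrite /= rot_mxD mulmxA. Qed.

Lemma turn_periodic p t x : turn p (t + tau) x = turn p t x.
Proof.
apply: sphere_coord_inj => k; rewrite !turn_coord.
by rewrite (_ : tau = pi *+ 2) ?mulr_natl// sinD2pi cosD2pi.
Qed.

Lemma polar_angle (a b : R) : exists2 t, 0 <= t <= tau &
  a = Num.sqrt (a ^+ 2 + b ^+ 2) * cos t /\ b = Num.sqrt (a ^+ 2 + b ^+ 2) * sin t.
Proof.
set r := Num.sqrt _.
have pi0 := pi_gt0 R.
have r2 : r ^+ 2 = a ^+ 2 + b ^+ 2 by rewrite sqr_sqrtr// addr_ge0// sqr_ge0.
have r0 : 0 <= r by exact: sqrtr_ge0.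
have [r00|rn0] := eqVneq r 0.
  exists 0; first by apply/andP; split=> //; lra.
  by rewrite r00 !mul0r; split; nra.
have {rn0}r0 : 0 < r by rewrite lt_def rn0.
have ar : -1 <= a / r <= 1.
  rewrite ler_pdivlMr// ler_pdivrMr//; apply/andP; split; nra.
have ca : r * cos (acos (a / r)) = a by rewrite acosK ?in_itv// mulrC divfK// gt_eqF.
have sa : r * sin (acos (a / r)) = `|b|.
  have s0 : 0 <= r * sin (acos (a / r)).
    by rewrite mulr_ge0 ?(ltW r0)// sin_ge0_pi// acos_ge0//= acos_lepi.
  apply/eqP; rewrite -(@eqrXn2 _ 2)//.
  rewrite exprMn sin2cos2 mulrBr -exprMn ca mulr1 r2 real_normK ?num_real//.
  by apply/eqP; ring.
have := acos_ge0 ar; have := acos_lepi ar => tpi t0.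
have [b0|b0] := leP 0 b.
  exists (acos (a / r)); first by apply/andP; split; lra.
  by rewrite ca sa ger0_norm.
exists (tau - acos (a / r)); first by apply/andP; split; lra.
by rewrite cos_tauB sin_tauB ca mulrN sa ltr0_norm// opprK.
Qed.

Lemma measurable_turn p t : measurable_fun [set: sphere] (turn p t).
Proof.
exact: (measurableT_comp (@measurable_rotate_rot R n n2 p) (pair2_measurable t)).
Qed.

Lemma bounded_measurable_turn p x f : bounded_measurable f ->
  bounded_measurable (fun t : R => f (turn p t x)).
Proof. by move=> bf; exact: (bounded_measurable_comp (measurable_rotate_rot1 p x)). Qed.

Definition pair_mean p f x : R := \int[circle]_t f (turn p t x).

Lemma pair_mean_turn p f x a : bounded_measurable f -> 0 <= a <= tau ->
  pair_mean p f (turn p a x) = pair_mean p f x.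
Proof.
move=> bf a2; rewrite /pair_mean -(@circle_mean_shift _ (fun t => f (turn p t x)) a)//.
- by apply: eq_Rintegral => t _; rewrite turnD.
- exact: bounded_measurable_turn.
- by move=> t; rewrite turn_periodic.
Qed.

Lemma turn_to_axis p x : exists2 a, 0 <= a <= tau &
  forall k, sphere_coord k (turn p a x) =
    if k == (val p).1 then
      Num.sqrt (sphere_coord (val p).1 x ^+ 2 + sphere_coord (val p).2 x ^+ 2)
    else if k == (val p).2 then 0 else sphere_coord k x.
Proof.
have [t t2] := polar_angle (sphere_coord (val p).1 x) (sphere_coord (val p).2 x).
set r := Num.sqrt _; clearbody r => -[ht1 ht2].
exists (tau - t) => [|k]; first by lra.
rewrite turn_coord ht1 ht2 cos_tauB sin_tauB.
case: ifPn => _; last by case: ifPn => // _; ring.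
by rewrite -[RHS]mulr1 -(cos2Dsin2 t); ring.
Qed.

Lemma bounded_measurable_pair_mean p f : bounded_measurable f -> (forall x, 0 <= f x) ->
  bounded_measurable (pair_mean p f).
Proof.
move=> bf f0; have [mf [M fM]] := bf; split; last first.
  exists M => x; rewrite /pair_mean ger0_norm; last exact: Rintegral_ge0.
  rewrite -[leRHS](mean_cst circle); apply: mean_le.
  - exact: bounded_measurable_turn.
  - exact: bounded_measurable_cst.
  - by move=> t; rewrite (le_trans (ler_norm _)).
pose F (z : sphere * R) := (f (turn p z.2 z.1))%:E.
have mF : measurable_fun [set: sphere * R] F.
  apply/measurable_EFinP; exact: (measurableT_comp mf (measurable_rotate_rot p)).
have := @measurable_fun_fubini_tonelli_F _ _ _ _ _ circle F mF.
move=> H.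
apply: (measurableT_comp (@fine_measurable R _ measurableT) (H _)).
by move=> z; rewrite lee_fin.
Qed.

End rotations.

(** * The kernel as an operator on functions *)

Section kac_mean.
Context (R : realType) (n : nat) (n2 : (1 < n)%N).
Notation sphere := (sphere R n2).
Notation circle := (uniform_prob (twopi_gt0 R)).
Implicit Types (p : coord_pair n) (x y : sphere) (f g : sphere -> R).

Definition kac_mean f x : R := 'C(n, 2)%:R^-1 * \sum_p pair_mean p f x.

Lemma bin2_gt0 : 0 < 'C(n, 2)%:R :> R.
Proof. by rewrite ltr0n bin_gt0. Qed.

Lemma pair_mean_ge0 p f x : (forall y, 0 <= f y) -> 0 <= pair_mean p f x.
Proof. by move=> f0; apply: Rintegral_ge0. Qed.

Lemma pair_meanD p f g x : bounded_measurable f -> bounded_measurable g ->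
  pair_mean p (fun y => f y + g y) x = pair_mean p f x + pair_mean p g x.
Proof. by move=> bf bg; apply: meanD; exact: bounded_measurable_turn. Qed.

Lemma pair_mean_cst p c x : pair_mean p (fun=> c) x = c.
Proof. exact: (mean_cst circle). Qed.

Lemma pair_mean_le p f g x : bounded_measurable f -> bounded_measurable g ->
  (forall y, f y <= g y) -> pair_mean p f x <= pair_mean p g x.
Proof. by move=> bf bg fg; apply: mean_le => //; exact: bounded_measurable_turn. Qed.

Lemma kac_mean_ge0 f x : (forall y, 0 <= f y) -> 0 <= kac_mean f x.
Proof.
move=> f0; rewrite mulr_ge0 ?invr_ge0//.
by apply: sumr_ge0 => p _; exact: pair_mean_ge0.
Qed.

Lemma bounded_measurable_kac_mean f : bounded_measurable f ->
  (forall x, 0 <= f x) -> bounded_measurable (kac_mean f).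
Proof.
move=> bf f0; apply: bounded_measurableM; first exact: bounded_measurable_cst.
by apply: bounded_measurable_sum => p; exact: bounded_measurable_pair_mean.
Qed.

Lemma kac_mean_cst c x : kac_mean (fun=> c) x = c.
Proof.
rewrite /kac_mean (eq_bigr (fun=> c)) => [|p _]; last exact: pair_mean_cst.
rewrite sumr_const card_coord_pair -[c *+ _]mulr_natl mulKf//.
by rewrite gt_eqF// bin2_gt0.
Qed.

Lemma kac_mean_le f g x : bounded_measurable f -> bounded_measurable g ->
  (forall y, f y <= g y) -> kac_mean f x <= kac_mean g x.
Proof.
move=> bf bg fg; rewrite ler_wpM2l ?invr_ge0//.
by apply: ler_sum => p _; exact: pair_mean_le.
Qed.

Lemma bounded_measurable_kac_mean_iter f k : bounded_measurable f -> (forall x, 0 <= f x) ->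
  bounded_measurable (iter k kac_mean f) /\ forall x, 0 <= iter k kac_mean f x.
Proof.
move=> bf f0; elim: k => [//|k [bk k0]] /=; split.
  exact: bounded_measurable_kac_mean.
by move=> x; exact: kac_mean_ge0.
Qed.

Lemma kac_mean_iter_le1 f k : bounded_measurable f -> (forall x, 0 <= f x) ->
  (forall x, f x <= 1) -> forall x, iter k kac_mean f x <= 1.
Proof.
move=> bf f0 f1; elim: k => [//|k IH] x /=.
rewrite -[leRHS](kac_mean_cst 1 x); apply: kac_mean_le => //.
- by have [] := bounded_measurable_kac_mean_iter k bf f0.
- exact: bounded_measurable_cst.
Qed.

Section invariance.
Variables (U : probability sphere R) (uU : is_uniform U).

(** Each single rotation preserves [U]; average over the angle. *)
Lemma uniform_pair_mean p f : bounded_measurable f -> (forall x, 0 <= f x) ->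
  \int[U]_x pair_mean p f x = \int[U]_x f x.
Proof.
move=> bf f0; have [mf _] := bf.
pose F (z : sphere * R) := (f (turn p z.2 z.1))%:E.
have mF : measurable_fun [set: sphere * R] F.
  by apply/measurable_EFinP; exact: (measurableT_comp mf (measurable_rotate_rot p)).
have F0 z : (0 <= F z)%E by rewrite lee_fin.
apply: EFin_inj; rewrite !mean_EFin//; last exact: bounded_measurable_pair_mean.
transitivity (\int[U]_x \int[circle]_t F (x, t))%E.
  apply: eq_integral => x _; rewrite /pair_mean mean_EFin//.
  exact: bounded_measurable_turn.
rewrite (@fubini_tonelli _ _ _ _ _ U circle F mF F0).
transitivity (\int[circle]_t ((\int[U]_x f x)%R)%:E)%E.
  apply: eq_integral => t _; rewrite mean_EFin//.
  transitivity (\int[pushforward U (turn p t)]_x (f x)%:E)%E.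
    rewrite ge0_integral_pushforward//.
    - exact: measurable_turn.
    - exact/measurable_EFinP.
    - by move=> x _; rewrite lee_fin.
  apply: eq_measure_integral; first exact: measurable_turn.
  by move=> mt A mA _; exact: (uU (Defs.rot p t) mA).
rewrite integral_cst//= mean_EFin// -[RHS]mule1; congr (_ * _)%E.
exact: (probability_setT circle).
Qed.

Lemma uniform_kac_mean f : bounded_measurable f -> (forall x, 0 <= f x) ->
  \int[U]_x kac_mean f x = \int[U]_x f x.
Proof.
move=> bf f0; rewrite /kac_mean meanZ; last first.
  by apply: bounded_measurable_sum => p; exact: bounded_measurable_pair_mean.
rewrite mean_sum => [|p]; last exact: bounded_measurable_pair_mean.
rewrite (eq_bigr (fun=> \int[U]_x f x)) => [|p _]; last exact: uniform_pair_mean.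
rewrite sumr_const card_coord_pair -[(\int[U]_x f x) *+ _]mulr_natl mulKf//.
by rewrite gt_eqF// bin2_gt0.
Qed.

Lemma uniform_kac_mean_iter f k : bounded_measurable f -> (forall x, 0 <= f x) ->
  \int[U]_x iter k kac_mean f x = \int[U]_x f x.
Proof.
move=> bf f0; elim: k => [//|k IH] /=.
by have [bk k0] := bounded_measurable_kac_mean_iter k bf f0; rewrite uniform_kac_mean.
Qed.

End invariance.

End kac_mean.

(** * The law of the walk *)

Section law.
Local Open Scope ereal_scope.

Lemma integral_kstep d (T : measurableType d) (R : realType)
    (mu : probability T R) (K : R.-pker T ~> T) (f : T -> \bar R) :
  measurable_fun [set: T] f -> (forall x, 0 <= f x) ->
  \int[kstep mu K]_x f x = \int[mu]_x \int[K x]_y f y.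
Proof.
move=> mf f0.
pose l : R.-sfker unit ~> T := kprobability (@measurable_cst _ _ unit (pprobability T R) setT mu).
pose k : R.-sfker (unit * T)%type ~> T := kernel.kernel_snd K.
exact: (@integral_kcomp _ _ _ _ _ _ _ l k tt f f0 mf).
Qed.

(** The kernel is a sum of images of the uniform law on the circle. *)
Lemma integral_kac (R : realType) (n : nat) (n2 : (1 < n)%N) (x : sphere R n2)
    (f : sphere R n2 -> R) : bounded_measurable f -> (forall y, (0 <= f y)%R) ->
  \int[kac R n2 x]_y (f y)%:E = (kac_mean f x)%:E.
Proof.
move=> bf f0.
have [mf _] := bf.
have mf' : measurable_fun setT (EFin \o f) by exact/measurable_EFinP.
pose P := uniform_prob (twopi_gt0 R).
pose s := index_enum (coord_pair n).
have [p0 _] : exists p0 : coord_pair n, p0 \in s.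
  have : (0 < #|{: coord_pair n}|)%N by rewrite card_coord_pair bin_gt0.
  by move=> /card_gt0P[p0 _]; exists p0; rewrite mem_index_enum.
pose m_ (k : nat) : {measure set (sphere R n2) -> \bar R} :=
  pushforward P (fun t => rotate (Defs.rot (nth p0 s k) t) x).
have mrot k : measurable_fun setT (fun t : R => rotate (Defs.rot (nth p0 s k) t) x).
  exact: measurable_rotate_rot1.
have C0 : (0 <= 'C(n, 2)%:R^-1 :> R)%R by rewrite invr_ge0.
pose m := mscale (NngNum C0) (msum (m_ mrot) (size s)).
transitivity (\int[m]_y (f y)%:E).
  apply: eq_measure_integral => A mA _.
  rewrite /m /mscale/= /msum/= /kac_prob; congr (_ * _).
  by rewrite (big_nth p0) big_mkord.
rewrite ge0_integral_mscale//; last by move=> y _; rewrite lee_fin.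
rewrite ge0_integral_measure_sum//; last by move=> y _; rewrite lee_fin.
rewrite /kac_mean EFinM; congr (_ * _)%E.
rewrite (big_nth p0) big_mkord -sumEFin; apply: eq_bigr => k _.
rewrite ge0_integral_pushforward//; last 2 first.
- exact: measurable_rotate_rot1.
- by move=> y _; rewrite lee_fin.
by rewrite preimage_setT /pair_mean mean_EFin//; exact: bounded_measurable_turn.
Qed.

Lemma mean_law (R : realType) (n : nat) (n2 : (1 < n)%N)
    (mu : probability (sphere R n2) R) (f : sphere R n2 -> R) (t : nat) :
  bounded_measurable f -> (forall y, 0 <= f y)%R ->
  (\int[law mu (kac R n2) t]_x f x = \int[mu]_x iter t (@kac_mean R n n2) f x)%R.
Proof.
elim: t f => [//|t IH] f bf f0.
have b1 := bounded_measurable_kac_mean bf f0.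
have k0 x : (0 <= kac_mean f x)%R by exact: kac_mean_ge0.
rewrite iterSr -(IH (kac_mean f))//; apply: EFin_inj; rewrite !mean_EFin//.
rewrite integral_kstep//; last by apply/measurable_EFinP; case: bf.
  by apply: eq_integral => x _; exact: integral_kac.
Qed.

End law.

(** * One step of the coalescing coupling *)

Section coalescence.
Context (R : realType) (n : nat) (n2 : (1 < n)%N).
Notation sphere := (sphere R n2).
Implicit Types (p : coord_pair n) (x y : sphere) (F B : sphere -> R).

Definition radius2 p x : R :=
  sphere_coord (val p).1 x ^+ 2 + sphere_coord (val p).2 x ^+ 2.

Lemma radius2_ge0 p x : 0 <= radius2 p x.
Proof. by rewrite addr_ge0 ?sqr_ge0. Qed.

Definition sqgap x y (k : 'I_n) : R := sphere_coord k x ^+ 2 - sphere_coord k y ^+ 2.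

(** The outcomes [(x', y')] of a coupled step from [(x, y)] in the plane [p] when
    the coupling succeeds.  Matching the first coordinates leaves to the second
    ones the whole difference of the squared radii; if the radii agree then the
    second coordinates agree too, because they have the same sign. *)
Definition coalesced p x y x' y' :=
  [/\ forall k, k != (val p).1 -> k != (val p).2 ->
        sphere_coord k x' = sphere_coord k x /\ sphere_coord k y' = sphere_coord k y,
      sphere_coord (val p).1 x' = sphere_coord (val p).1 y',
      sqgap x' y' (val p).2 = radius2 p x - radius2 p y &
      radius2 p x = radius2 p y ->
        sphere_coord (val p).2 x' = sphere_coord (val p).2 y'].

(** Turning the starting point within its orbit changes no mean over the orbit, so
    it can be put on the first axis of the plane. *)
Lemma pair_mean_axis p x : exists x0,
  [/\ forall f, bounded_measurable f -> pair_mean p f x0 = pair_mean p f x,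
      forall t, sphere_coord (val p).1 (turn p t x0) = Num.sqrt (radius2 p x) * cos t,
      forall t, sphere_coord (val p).2 (turn p t x0) = Num.sqrt (radius2 p x) * sin t &
      forall t k, k != (val p).1 -> k != (val p).2 ->
        sphere_coord k (turn p t x0) = sphere_coord k x].
Proof.
have [a a2 ax] := turn_to_axis p x.
have ji := coord_pair_neq p; rewrite eq_sym in ji.
exists (turn p a x); split => [f bf|t|t|t k ki kj].
- exact: pair_mean_turn.
- by rewrite turn_coord eqxx !ax eqxx (negbTE ji) eqxx mulr0 subr0 mulrC.
- by rewrite turn_coord (negbTE ji) eqxx !ax eqxx (negbTE ji) eqxx mulr0 addr0 mulrC.
- by rewrite turn_coord (negbTE ki) (negbTE kj) ax (negbTE ki) (negbTE kj).
Qed.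

Lemma coalesced_axis p x y x0 y0 s t :
  (forall t, sphere_coord (val p).1 (turn p t x0) = Num.sqrt (radius2 p x) * cos t) ->
  (forall t, sphere_coord (val p).2 (turn p t x0) = Num.sqrt (radius2 p x) * sin t) ->
  (forall t k, k != (val p).1 -> k != (val p).2 ->
        sphere_coord k (turn p t x0) = sphere_coord k x) ->
  (forall t, sphere_coord (val p).1 (turn p t y0) = Num.sqrt (radius2 p y) * cos t) ->
  (forall t, sphere_coord (val p).2 (turn p t y0) = Num.sqrt (radius2 p y) * sin t) ->
  (forall t k, k != (val p).1 -> k != (val p).2 ->
        sphere_coord k (turn p t y0) = sphere_coord k y) ->
  Num.sqrt (radius2 p x) * cos s = Num.sqrt (radius2 p y) * cos t ->
  0 <= sin s * sin t ->
  coalesced p x y (turn p s x0) (turn p t y0).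
Proof.
move=> xi xj xk yi yj yk cst sst.
have x2 := sqr_sqrtr (radius2_ge0 p x); have y2 := sqr_sqrtr (radius2_ge0 p y).
split.
- by move=> k ki kj; rewrite xk ?yk.
- by rewrite xi yi.
- rewrite /sqgap xj yj !exprMn !sin2cos2 !mulrBr !mulr1 -!exprMn cst x2 y2; ring.
- move=> exy; rewrite xj yj exy.
  have [->|r0] := eqVneq (Num.sqrt (radius2 p y)) 0; first by rewrite !mul0r.
  congr (_ * _); rewrite exy in cst.
  have {}cst : cos s = cos t by apply: (mulfI r0).
  have s2 : sin s ^+ 2 = sin t ^+ 2 by rewrite !sin2cos2 cst.
  move/eqP: s2; rewrite eqf_sqr => /orP[/eqP//|/eqP st].
  move: sst; rewrite st mulNr -expr2 oppr_ge0 => st2.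
  have /eqP := le_anti (introT andP (conj st2 (sqr_ge0 _))).
  by rewrite sqrf_eq0 => /eqP ->; rewrite oppr0.
Qed.

Lemma sqrt_defect (a b eta : R) : 0 <= a -> a <= b -> 0 < eta -> eta <= b ->
  Num.sqrt (1 - (Num.sqrt a / Num.sqrt b) ^+ 2) <= Num.sqrt (`|a - b| / eta).
Proof.
move=> a0 ab eta0 etab.
have b0 : 0 < b by exact: (lt_le_trans eta0).
rewrite expr_div_n !sqr_sqrtr ?(ltW b0)// ler_wsqrtr//.
rewrite ler0_norm ?subr_le0// opprB.
rewrite (_ : 1 - a / b = (b - a) / b); last by field; rewrite gt_eqF.
by rewrite ler_wpM2l ?subr_ge0// lef_pV2.
Qed.

(** The circle with the larger radius has to be projected onto the other one.
    If it is the one through [y], the comparison is applied to [1 - F], which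
    exchanges the two sides of the inequality. *)
Lemma pair_mean_coalesce p x y F B (eta w : R) :
  bounded_measurable F -> (forall z, 0 <= F z <= 1) ->
  bounded_measurable B -> (forall z, 0 <= B z) -> 0 <= w ->
  0 < eta -> eta <= radius2 p y ->
  (forall x' y', coalesced p x y x' y' -> F x' <= F y' + B y' + w) ->
  pair_mean p F x <= pair_mean p F y + pair_mean p B y + w +
    2 * Num.sqrt (`|radius2 p x - radius2 p y| / eta).
Proof.
move=> bF F01 bB B0 w0 eta0 etay H.
have [x0 [Qx xi xj xk]] := pair_mean_axis p x.
have [y0 [Qy yi yj yk]] := pair_mean_axis p y.
have H' s t : Num.sqrt (radius2 p x) * cos s = Num.sqrt (radius2 p y) * cos t ->
    0 <= sin s * sin t ->
    F (turn p s x0) <= F (turn p t y0) + B (turn p t y0) + w.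
  by move=> cst sst; apply: H; exact: coalesced_axis.
rewrite -(Qx F)// -(Qy F)// -(Qy B)// {H Qx Qy}.
have bFx := bounded_measurable_turn p x0 bF.
have bFy := bounded_measurable_turn p y0 bF.
have bBy := bounded_measurable_turn p y0 bB.
have b1 := @bounded_measurable_cst _ R R 1.
have ry0 := lt_le_trans eta0 etay.
have [xy|yx] := leP (radius2 p x) (radius2 p y).
  have sy0 : 0 < Num.sqrt (radius2 p y) by rewrite sqrtr_gt0.
  have c01 : 0 <= Num.sqrt (radius2 p x) / Num.sqrt (radius2 p y) <= 1.
    rewrite divr_ge0 ?sqrtr_ge0//= ler_pdivrMr// mul1r; exact: ler_wsqrtr.
  have := @circle_mean_projection R _ w
    (fun t => 1 - F (turn p t y0) - B (turn p t y0)) (fun t => 1 - F (turn p t x0)) c01 w0.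
  rewrite !meanB//; last exact: bounded_measurableB.
  rewrite mean_cst -/(pair_mean p F x0) -/(pair_mean p F y0) -/(pair_mean p B y0).
  have := sqrt_defect (radius2_ge0 p x) xy eta0 etay.
  set S := Num.sqrt (1 - _); set T := Num.sqrt (_ / eta) => ST.
  move=> /(_ _ _ _ _ _) h.
  suff : 1 - pair_mean p F y0 - pair_mean p B y0 <= 1 - pair_mean p F x0 + w + 2 * S.
    by move: ST; clear; lra.
  apply: h.
  - by apply: bounded_measurableB => //; exact: bounded_measurableB.
  - exact: bounded_measurableB.
  - by move=> t; have /andP[] := F01 (turn p t y0); have := B0 (turn p t y0); lra.
  - by move=> t; have /andP[] := F01 (turn p t x0); lra.
  - move=> t s cts sts; have := H' s t; rewrite mulrC [_ * sin t]mulrC sts cts.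
    by rewrite mulrA mulrCA divff ?gt_eqF// mulr1 mulrC => /(_ erefl isT); lra.
have sx0 : 0 < Num.sqrt (radius2 p x) by rewrite sqrtr_gt0 (lt_trans ry0).
have c01 : 0 <= Num.sqrt (radius2 p y) / Num.sqrt (radius2 p x) <= 1.
  by rewrite divr_ge0 ?sqrtr_ge0//= ler_pdivrMr// mul1r; apply: ler_wsqrtr; exact: ltW.
have := @circle_mean_projection R _ w
  (fun t => F (turn p t x0)) (fun t => F (turn p t y0) + B (turn p t y0)) c01 w0.
rewrite meanD// -/(pair_mean p F x0) -/(pair_mean p F y0) -/(pair_mean p B y0).
have := sqrt_defect (radius2_ge0 p y) (ltW yx) eta0 (le_trans etay (ltW yx)).
rewrite distrC.
set S := Num.sqrt (1 - _); set T := Num.sqrt (_ / eta) => ST.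
move=> h.
suff : pair_mean p F x0 <= pair_mean p F y0 + pair_mean p B y0 + w + 2 * S.
  by move: ST; clear; lra.
apply: h => //.
- exact: bounded_measurableD.
- by move=> t; have /andP[] := F01 (turn p t x0); lra.
- by move=> t; have /andP[] := F01 (turn p t y0); have := B0 (turn p t y0); lra.
- move=> s t cts sts; apply: H' => //; rewrite cts.
  by rewrite mulrA mulrCA divff ?gt_eqF// mulr1 mulrC.
Qed.

End coalescence.

(** * The number of differing coordinates *)

Section coalescence_count.
Context (R : realType) (n : nat) (n2 : (1 < n)%N).
Notation sphere := (sphere R n2).
Implicit Types (p : coord_pair n) (x y : sphere).

Definition gap x y : R := \sum_k `|sqgap x y k|.

Definition mismatch x y : {set 'I_n} :=
  finset (fun k => sphere_coord k x != sphere_coord k y).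

Lemma in_mismatch x y k :
  (k \in mismatch x y) = (sphere_coord k x != sphere_coord k y).
Proof. by rewrite inE. Qed.

Lemma sqgap_eq0 x y k : k \notin mismatch x y -> sqgap x y k = 0.
Proof. by rewrite in_mismatch negbK /sqgap => /eqP ->; rewrite subrr. Qed.

Lemma radius2B p x y :
  radius2 p x - radius2 p y = sqgap x y (val p).1 + sqgap x y (val p).2.
Proof. by rewrite /radius2 /sqgap opprD addrACA. Qed.

Lemma sqgap_sum x y : \sum_k sqgap x y k = 0.
Proof. by rewrite /sqgap sumrB !sphere_coord_sum subrr. Qed.

Lemma sum_coord_pair p (f : 'I_n -> R) : \sum_k f k = f (val p).1 + f (val p).2 +
  \sum_(k | (k != (val p).1) && (k != (val p).2)) f k.
Proof.
rewrite (bigD1 (val p).1)//= (bigD1 (val p).2)/= ?addrA//.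
by rewrite eq_sym coord_pair_neq.
Qed.

Lemma radius2B_le_gap p x y : `|radius2 p x - radius2 p y| <= gap x y.
Proof.
rewrite radius2B (le_trans (ler_normD _ _))// /gap (sum_coord_pair p) lerDl.
by apply: sumr_ge0.
Qed.

Lemma coalesced_gap p x y x' y' : coalesced p x y x' y' -> gap x' y' <= gap x y.
Proof.
move=> [off eqi gapj _]; rewrite /gap !(sum_coord_pair p).
rewrite gapj radius2B {1}/sqgap eqi subrr normr0 add0r lerD ?ler_normD//.
apply: ler_sum => k /andP[ki kj].
by have [kx ky] := off k ki kj; rewrite /sqgap kx ky.
Qed.

Lemma coalesced_mismatch p x y x' y' k : coalesced p x y x' y' ->
  k \in mismatch x' y' ->
  (k != (val p).1) && ((k \in mismatch x y) && (k != (val p).2) ||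
    (k == (val p).2) && (radius2 p x != radius2 p y)).
Proof.
move=> [off eqi gapj eqj]; rewrite !in_mismatch => kxy.
have [ki|ki] /= := eqVneq k (val p).1; first by rewrite ki eqi eqxx in kxy.
have [kj|kj] /= := eqVneq k (val p).2; last first.
  by rewrite orbF andbT; have [kx ky] := off k ki kj; rewrite kx ky in kxy.
by rewrite andbF/=; apply: contra_neq kxy => r; rewrite kj eqj.
Qed.

(** The planes whose selection lowers the number of differing coordinates.  Of two
    differing coordinates the first becomes equal; if the radii agree, both do. *)
Definition merging p x y :=
  [|| (val p).1 \in mismatch x y | (val p).2 \in mismatch x y] &&
  ((radius2 p x == radius2 p y) ||
    ((val p).1 \in mismatch x y) && ((val p).2 \in mismatch x y)).

Lemma coalesced_card_lt p x y x' y' : coalesced p x y x' y' -> merging p x y ->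
  (#|mismatch x' y'| < #|mismatch x y|)%N.
Proof.
move=> co; have sub := coalesced_mismatch co.
rewrite /merging; set i := (val p).1 in sub *; set j := (val p).2 in sub *.
move=> mer; apply: proper_card; apply/fintype.properP; split.
  apply/fintype.subsetP => k /sub /andP[ki /orP[/andP[]//|/andP[/eqP -> r]]].
  by move: mer; rewrite (negbTE r) => /andP[_ /andP[]].
have [iA|iA] := boolP (i \in mismatch x y).
  by exists i => //; apply/negP => /sub; rewrite eqxx.
move: mer; rewrite (negbTE iA) /= orbF => /andP[jA r].
by exists j => //; apply/negP => /sub; rewrite r eqxx /= !andbF.
Qed.

Lemma coalesced_card_le p x y x' y' : coalesced p x y x' y' ->
  (#|mismatch x' y'| <= #|mismatch x y|)%N.
Proof.
move=> co; have sub := coalesced_mismatch co.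
have [mer|] := boolP (merging p x y); first exact/ltnW/(coalesced_card_lt co).
rewrite /merging; set i := (val p).1 in sub *; set j := (val p).2 in sub *.
have [jA|jA] := boolP (j \in mismatch x y).
  move=> _; apply: subset_leq_card.
  by apply/fintype.subsetP => k /sub /andP[ki /orP[/andP[]//|/andP[/eqP -> _]]].
have [iA|iA] := boolP (i \in mismatch x y); last first.
  move=> _; apply: subset_leq_card.
  apply/fintype.subsetP => k /sub /andP[ki /orP[/andP[]//|/andP[_]]].
  by rewrite -subr_eq0 radius2B !sqgap_eq0// addr0 eqxx.
move=> _; rewrite (cardsD1 i (mismatch x y)) iA.
apply: (@leq_trans #|j |: (mismatch x y :\ i)|%SET); last first.
  by rewrite cardsU1 leq_add2r; case: (_ \notin _).
apply: subset_leq_card; apply/fintype.subsetP => k /sub.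
rewrite finset.in_setU1 finset.in_setD1.
move=> /andP[->] /orP[/andP[-> _]|/andP[-> _]]//=.
by rewrite orbT.
Qed.

(** If two coordinates differ, their plane will do.  If only one differs, its
    difference of squares is the sum of all differences of squares, which is
    [0], so that the radii agree in any plane that contains it. *)
Lemma exists_merging x y : x != y -> exists p, merging p x y.
Proof.
move=> xy.
have [a aA] : exists a, a \in mismatch x y.
  apply/existsP; apply: contraNT xy; rewrite negb_exists => /forallP xy.
  apply/eqP/sphere_coord_inj => k.
  by apply/eqP; have := xy k; rewrite in_mismatch negbK.
have pair b : b != a -> (b \in mismatch x y) || (sqgap x y a + sqgap x y b == 0) ->
    exists p, merging p x y.
  move=> ba bP.
  have ord (c d : 'I_n) : (c < d)%N -> (c \in mismatch x y) || (d \in mismatch x y) ->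
      (c \in mismatch x y) && (d \in mismatch x y) || (sqgap x y c + sqgap x y d == 0) ->
      exists p, merging p x y.
    move=> cd cdA cdP; exists (exist _ (c, d) cd : coord_pair n).
    by rewrite /merging /= cdA -subr_eq0 radius2B/= orbC.
  case: (ltngtP a b) => [ab|ab|/val_inj ab].
  - by apply: (ord a b); rewrite ?aA.
  - by apply: (ord b a) => //; rewrite aA ?orbT// andbT addrC.
  - by rewrite ab eqxx in ba.
have [[b /andP[ba bA]]|noA] := pselect (exists b, (b != a) && (b \in mismatch x y)).
  by apply: (pair b) => //; rewrite bA.
have off k : k != a -> k \notin mismatch x y.
  by move=> ka; apply/negP => kA; apply: noA; exists k; rewrite ka.
have [b ba] : exists b : 'I_n, b != a.
  have : (1 < #|[set: 'I_n]%SET|)%N by rewrite cardsT card_ord.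
  rewrite (cardsD1 a) inE ltnS => /card_gt0P[b]; rewrite !inE andbT => ba.
  by exists b.
apply: (pair b ba); rewrite (sqgap_eq0 (off b ba)) addr0.
have := sqgap_sum x y; rewrite (bigD1 a)//= big1 ?addr0 => [->|k ka].
  by rewrite eqxx orbT.
by rewrite sqgap_eq0// off.
Qed.

End coalescence_count.

(** * Meeting of two nearby walks *)

Section coalescence_bound.
Context (R : realType) (n : nat) (n2 : (1 < n)%N).
Notation sphere := (sphere R n2).
Implicit Types (p : coord_pair n) (x y : sphere).
Variable eta : R.
Hypothesis eta0 : 0 < eta.

Definition near_axis p : set sphere := [set x | radius2 p x < eta].

Lemma measurable_near_axis p : measurable (near_axis p).
Proof.
have m : measurable_fun [set: sphere] (@radius2 R n n2 p).
  by apply: measurable_funD; apply: measurable_funX; exact: measurable_sphere_coord.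
rewrite (_ : near_axis p = [set: sphere] `&` @radius2 R n n2 p @^-1` `]-oo, eta[).
  by apply: m => //; exact: measurable_itv.
by rewrite setTI; apply/seteqP; split => x /=; rewrite in_itv.
Qed.

(** The probability that the next step selects a plane in which the projection of
    [x] is too short for the coupling to be cheap. *)
Definition axis_risk x : R := 'C(n, 2)%:R^-1 * \sum_p \1_(near_axis p) x.

Lemma axis_risk_ge0 x : 0 <= axis_risk x.
Proof.
rewrite mulr_ge0 ?invr_ge0//; apply: sumr_ge0 => p _.
by rewrite indicE.
Qed.

Lemma bounded_measurable_axis_risk : bounded_measurable axis_risk.
Proof.
apply: bounded_measurableM; first exact: bounded_measurable_cst.
apply: bounded_measurable_sum => p; apply: bounded_measurable_indic.
exact: measurable_near_axis.
Qed.

(** The sum of [K^s axis_risk] over [s < t]: the expected number of bad selections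
    during [t] steps from the given point. *)
Fixpoint axis_loss (t : nat) : sphere -> R :=
  if t is s.+1 then fun x => axis_risk x + kac_mean (axis_loss s) x else fun=> 0.

Lemma axis_loss_spec t : bounded_measurable (axis_loss t) /\ forall x, 0 <= axis_loss t x.
Proof.
elim: t => [|t [bt t0]] /=; first by split => //; exact: bounded_measurable_cst.
split.
  apply: bounded_measurableD; first exact: bounded_measurable_axis_risk.
  exact: bounded_measurable_kac_mean.
by move=> x; rewrite addr_ge0 ?axis_risk_ge0// kac_mean_ge0.
Qed.

Lemma uniform_axis_loss (U : probability sphere R) (t : nat) : is_uniform U ->
  \int[U]_x axis_loss t x = t%:R * \int[U]_x axis_risk x.
Proof.
move=> uU; elim: t => [|t IH] /=; first by rewrite mean_cst mul0r.
have [bt t0] := axis_loss_spec t; have br := bounded_measurable_axis_risk.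
rewrite meanD//; last exact: bounded_measurable_kac_mean.
by rewrite uniform_kac_mean// IH -addn1 natrD mulrDl mul1r addrC.
Qed.

(** Each step costs [2 * Num.sqrt (Delta / eta)] for the failure of the coupling,
    unless the selected plane is bad, which [axis_loss] accounts for.  The last
    term bounds the probability that coordinates still differ: [2 ^+ N], with
    [N] the number of differing coordinates, never grows and is halved with
    probability at least ['C(n, 2)%:R^-1]. *)
Lemma kac_mean_iter_coalesce (Delta : R) (F : sphere -> R) (t : nat) x y :
  0 <= Delta -> bounded_measurable F -> (forall z, 0 <= F z <= 1) ->
  gap x y <= Delta ->
  iter t (@kac_mean R n n2) F x <= iter t (@kac_mean R n n2) F y + axis_loss t y +
    t%:R * (2 * Num.sqrt (Delta / eta)) +
    2 ^+ #|mismatch x y| * (1 - 2^-1 / 'C(n, 2)%:R) ^+ t.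
Proof.
move=> D0 bF F01; set kappa := 2 * Num.sqrt _; set rho := 1 - _.
have kappa0 : 0 <= kappa by rewrite mulr_ge0// sqrtr_ge0.
have C1 : 1 <= 'C(n, 2)%:R :> R by rewrite ler1n bin_gt0.
have C0 : 0 < 'C(n, 2)%:R :> R by exact: bin2_gt0.
have rho0 : 0 <= rho.
  rewrite /rho subr_ge0 ler_pdivrMr// mul1r (le_trans _ C1)//; lra.
have F0 z : 0 <= F z by have /andP[] := F01 z.
have F1 z : F z <= 1 by have /andP[] := F01 z.
elim: t x y => [|t IH] x y xy.
  rewrite /= mul0r expr0 mulr1 !addr0.
  have [->|xNy] := eqVneq x y; first by rewrite lerDl exprn_ge0.
  have pow1 : 1 <= 2 ^+ #|mismatch x y| :> R by rewrite exprn_ege1// ler1n.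
  by rewrite (le_trans (F1 x))// (le_trans pow1)// lerDr.
have [->|xNy] := eqVneq x y.
  have [_ l0] := axis_loss_spec t.+1.
  have k0 : 0 <= t.+1%:R * kappa by rewrite mulr_ge0.
  have m0 : 0 <= 2 ^+ #|mismatch y y| * rho ^+ t.+1 by rewrite mulr_ge0 ?exprn_ge0.
  rewrite -2!addrA lerDl; apply: addr_ge0; first exact: l0.
  exact: addr_ge0.
have [p0 mer0] := exists_merging xNy.
have [bt t0] := bounded_measurable_kac_mean_iter t bF F0.
have t1 := kac_mean_iter_le1 t bF F0 F1.
have [bl l0] := axis_loss_spec t.
rewrite [iter t.+1 _ _]/= [axis_loss _]/= /=.
set G := iter t _ F in IH bt t0 t1 *.
set N := #|mismatch x y|.
(* A merging plane halves 2 ^+ N. *)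
pose e p : R := (if merging p x y then 2^-1 else 1) * (2 ^+ N * rho ^+ t).
have e0 p : 0 <= e p.
  by rewrite /e mulr_ge0 ?mulr_ge0 ?exprn_ge0//; case: ifP => // _; rewrite ?invr_ge0.
have step p : pair_mean p G x <= pair_mean p G y + pair_mean p (axis_loss t) y +
    \1_(near_axis p) y + (t.+1%:R * kappa) + e p.
  have G0 := pair_mean_ge0 p y t0; have L0 := pair_mean_ge0 p y l0.
  have tk0 : 0 <= t.+1%:R * kappa by rewrite mulr_ge0.
  rewrite indicE; case: (boolP (y \in near_axis p)) => yp.
    have : pair_mean p G x <= 1.
      rewrite -[leRHS](pair_mean_cst p 1 x); apply: pair_mean_le => //.
      exact: bounded_measurable_cst.
    by have := e0 p; rewrite mulr1n; lra.
  rewrite addr0.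
  have etay : eta <= radius2 p y.
    by move: yp; rewrite notin_setE /near_axis/= => /negP; rewrite -leNgt.
  have := @pair_mean_coalesce R n n2 p x y G (axis_loss t) eta (t%:R * kappa + e p) bt _ bl l0.
  move=> /(_ _ _ eta0 etay _) h.
  apply: (le_trans (h _ _ _)).
  - by move=> z; rewrite t0 t1.
  - by rewrite addr_ge0// mulr_ge0.
  - move=> x' y' co; rewrite addrA; apply: (le_trans (IH x' y' _)).
      exact: le_trans (coalesced_gap co) xy.
    rewrite lerD2l /e mulrA ler_wpM2r ?exprn_ge0//.
    case: ifP => [mer|_]; last first.
      by rewrite mul1r ler_weXn2l ?ler1n//; exact: coalesced_card_le co.
    rewrite ler_pdivlMl// -exprS ler_weXn2l ?ler1n//; exact: coalesced_card_lt co mer.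
  have : 2 * Num.sqrt (`|radius2 p x - radius2 p y| / eta) <= kappa.
    rewrite /kappa ler_wpM2l// ler_wsqrtr// ler_wpM2r ?invr_ge0 ?(ltW eta0)//.
    exact: le_trans (radius2B_le_gap p x y) xy.
  have -> : t.+1%:R * kappa = t%:R * kappa + kappa by rewrite -addn1 natrD mulrDl mul1r.
  lra.
have sum_e : \sum_p e p <= 'C(n, 2)%:R * (2 ^+ N * rho ^+ t.+1).
  rewrite (bigD1 p0)//= {1}/e mer0.
  apply: (@le_trans _ _ (2^-1 * (2 ^+ N * rho ^+ t) +
      \sum_(p | p != p0) (2 ^+ N * rho ^+ t))).
    rewrite lerD2l; apply: ler_sum => p _; rewrite /e ler_piMl//.
      by rewrite mulr_ge0// exprn_ge0.
    by case: ifP => // _; rewrite invf_le1// ler1n.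
  have -> : \sum_(p : coord_pair n | p != p0) (2 ^+ N * rho ^+ t) =
      ('C(n, 2)%:R - 1) * (2 ^+ N * rho ^+ t).
    have : \sum_(p : coord_pair n) (2 ^+ N * rho ^+ t) =
        'C(n, 2)%:R * (2 ^+ N * rho ^+ t).
      by rewrite sumr_const card_coord_pair -[(_ * _) *+ _]mulr_natl.
    by rewrite (bigD1 p0)//= mulrBl mul1r => <-; rewrite addrAC subrr add0r.
  have -> : rho ^+ t.+1 = (1 - 2^-1 / 'C(n, 2)%:R) * rho ^+ t by rewrite exprS.
  rewrite le_eqVlt; apply/orP; left; apply/eqP.
  by move: C0 (2 ^+ N) (rho ^+ t); clear => C0 a b; field; rewrite gt_eqF.
rewrite {1 2}/kac_mean /axis_risk.
apply: (@le_trans _ _ ('C(n, 2)%:R^-1 * \sum_p (pair_mean p G y +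
    pair_mean p (axis_loss t) y + \1_(near_axis p) y + (t.+1%:R * kappa) + e p))).
  by rewrite ler_wpM2l ?invr_ge0//; apply: ler_sum => p _; exact: step.
rewrite !big_split/= sumr_const card_coord_pair !mulrDr.
rewrite -[(_ * kappa) *+ _]mulr_natl mulKf ?gt_eqF//.
apply: lerD; first by rewrite lerD2r -addrA lerD2l addrC.
by rewrite ler_pdivrMl.
Qed.

End coalescence_bound.

(** * Contraction of the squared coordinates *)

Section contraction.
Context (R : realType) (n : nat) (n2 : (1 < n)%N).
Notation sphere := (sphere R n2).
Notation circle := (uniform_prob (twopi_gt0 R)).
Notation tau := (2 * pi : R).
Implicit Types (p : coord_pair n) (x y : sphere).

Lemma sum_coord_pairs (phi : 'I_n -> 'I_n -> R) : (forall i j, phi i j = phi j i) ->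
  \sum_(p : coord_pair n) phi (val p).1 (val p).2 *+ 2 =
  \sum_i \sum_j phi i j - \sum_i phi i i.
Proof.
move=> sym.
have -> : \sum_(p : coord_pair n) phi (val p).1 (val p).2 *+ 2 =
    (\sum_(q : 'I_n * 'I_n | (q.1 < q.2)%N) phi q.1 q.2) *+ 2.
  rewrite -sumrMnl (reindex_omap val (insub : 'I_n * 'I_n -> option (coord_pair n))).
    by apply: eq_bigl => q; rewrite valK eqxx (valP q).
  by move=> q q2; rewrite insubT.
rewrite -(pair_big_dep predT (fun i j : 'I_n => (i < j)%N) (fun i j => phi i j))/=.
rewrite -sumrB mulr2n {2}(exchange_big_dep predT)//= -big_split/=.
apply: eq_bigr => i _; rewrite [in RHS](bigD1 i)//= addrAC subrr add0r.
rewrite [RHS](bigID (fun j : 'I_n => (i < j)%N))/=; congr (_ + _).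
  by apply: eq_bigl => j; case: eqVneq => [->|//]; rewrite ltnn.
apply: eq_big => [j|j _]; last exact: sym.
by rewrite -leqNgt ltn_neqAle.
Qed.

Definition sqdist x y : R := \sum_k sqgap x y k ^+ 2.

(** The mean of [sqdist] after a step in the plane [p] that brings both points on
    the same ray. *)
Definition pair_sqdist p x y : R := sqdist x y
  - (sqgap x y (val p).1 ^+ 2 + sqgap x y (val p).2 ^+ 2)
  + 3 / 4 * (sqgap x y (val p).1 + sqgap x y (val p).2) ^+ 2.

(** The cross terms [d_i d_j] sum to [- sqdist x y / 2] because the [d_k] sum to
    [0]. *)
Lemma sum_pair_sqdist x y :
  'C(n, 2)%:R^-1 * \sum_p pair_sqdist p x y <= (1 - (2 * n%:R)^-1) * sqdist x y.
Proof.
have n0 : 0 < n%:R :> R by rewrite ltr0n ltnW.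
have S0 : 0 <= sqdist x y by apply: sumr_ge0 => k _; exact: sqr_ge0.
pose d := sqgap x y.
pose phi i j : R := - (d i ^+ 2 + d j ^+ 2) + 3 / 4 * (d i + d j) ^+ 2.
have phiE i j : phi i j = - (1 / 4) * d i ^+ 2 + (- (1 / 4) * d j ^+ 2 + 3 / 2 * d i * d j).
  by rewrite /phi; field.
have sum_phi : \sum_(p : coord_pair n) phi (val p).1 (val p).2 *+ 2 =
    - (1 / 2) * n%:R * sqdist x y - sqdist x y.
  rewrite sum_coord_pairs; last by move=> i j; rewrite /phi addrC [d i + d j]addrC; ring.
  have -> : \sum_i phi i i = sqdist x y.
    by rewrite /sqdist; apply: eq_bigr => i _; rewrite /phi -/(d i); field.
  congr (_ - _).
  have SE : \sum_j d j ^+ 2 = sqdist x y by [].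
  have inner i : \sum_j phi i j = - (1 / 4) * n%:R * d i ^+ 2 - 1 / 4 * sqdist x y.
    under eq_bigr do rewrite phiE.
    rewrite !big_split/= sumr_const card_ord -!mulr_sumr sqgap_sum mulr0 addr0.
    by rewrite -[(_ * _) *+ n]mulr_natl SE; ring.
  under eq_bigr do rewrite inner.
  rewrite big_split/= sumr_const card_ord -mulr_sumr SE.
  by rewrite -[(- _) *+ n]mulr_natl; field.
have C2 : 'C(n, 2)%:R = n%:R * (n%:R - 1) / 2 :> R.
  have n_ge1 := ltnW n2.
  have := congr1 (fun k : nat => k%:R : R) (mul_bin_left n 1).
  by rewrite bin1 !natrM natrB// => E; move: E; nra.
have n1 : 0 < n%:R - 1 :> R by rewrite subr_gt0 ltr1n.
rewrite ler_pdivrMl; last by rewrite C2 divr_gt0// mulr_gt0.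
have -> : \sum_p pair_sqdist p x y = 'C(n, 2)%:R * sqdist x y +
    \sum_(p : coord_pair n) phi (val p).1 (val p).2.
  rewrite -card_coord_pair mulr_natl -sumr_const -big_split/=.
  by apply: eq_bigr => p _; rewrite /pair_sqdist /phi -/d; ring.
rewrite sumrMnl in sum_phi.
have : \sum_(p : coord_pair n) phi (val p).1 (val p).2 =
    (- (1 / 2) * n%:R * sqdist x y - sqdist x y) / 2.
  by move: sum_phi; rewrite mulr2n; lra.
move=> ->; rewrite C2.
have -> : n%:R * (n%:R - 1) / 2 * ((1 - (2 * n%:R)^-1) * sqdist x y) =
    n%:R * (n%:R - 1) / 2 * sqdist x y - (n%:R - 1) / 4 * sqdist x y.
  by field; rewrite gt_eqF.
by clear -S0; lra.
Qed.

Lemma bounded_measurable_fourth_powers :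
  bounded_measurable (fun t : R => cos t ^+ 4 + sin t ^+ 4).
Proof.
split.
  apply: measurable_funD; apply: measurable_funX; apply: continuous_measurable_fun.
    exact: continuous_cos.
  exact: continuous_sin.
exists 2 => t; rewrite (le_trans (ler_normD _ _))// !normrX.
have c1 := cos_max t; have s1 := sin_max t.
by rewrite -[leRHS]/(1 + 1) lerD// exprn_ile1.
Qed.

(** As [cos^4 + sin^4 = 1 - sin (2t) ^ 2 / 2], its values at [t] and [t + pi / 4]
    add up to [3/2]; the shift does not change the mean. *)
Lemma mean_fourth_powers : \int[circle]_t (cos t ^+ 4 + sin t ^+ 4) = 3 / 4.
Proof.
pose q (t : R) : R := cos t ^+ 4 + sin t ^+ 4.
have pi0 := pi_gt0 R.
have bq : bounded_measurable q by exact: bounded_measurable_fourth_powers.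
have qE t : q t = 1 - sin (t *+ 2) ^+ 2 / 2.
  rewrite /q sin_mulr2n -[(cos t * sin t) *+ 2]mulr_natl.
  have -> : cos t ^+ 4 + sin t ^+ 4 =
      (cos t ^+ 2 + sin t ^+ 2) ^+ 2 - 2 * (cos t * sin t) ^+ 2 by ring.
  by rewrite cos2Dsin2 expr1n; field.
have pq : periodic q tau.
  by move=> t; rewrite /q (_ : tau = pi *+ 2) ?mulr_natl// sinD2pi cosD2pi.
have pi4 : 0 <= (pi / 4 : R) <= tau by lra.
have shift := circle_mean_shift bq pq pi4.
have : \int[circle]_t (q t + q (t + pi / 4)) = \int[circle]_t (3 / 2 : R).
  apply: eq_Rintegral => t _; rewrite !qE mulrnDl (_ : pi / 4 *+ 2 = pi / 2); last first.
    by rewrite -mulr_natr; field.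
  rewrite sinDpihalf; have := cos2Dsin2 (t *+ 2).
  by lra.
rewrite mean_cst meanD//; last first.
  by apply: (bounded_measurable_comp _ bq); exact: measurable_funD.
rewrite shift -/(q _) => E.
by rewrite -[LHS]/(\int[circle]_t q t); move: E; set I := \int[circle]_x _; clearbody I; lra.
Qed.

End contraction.

(** * The proportional coupling *)

Section proportional.
Context (R : realType) (n : nat) (n2 : (1 < n)%N).
Notation sphere := (sphere R n2).
Notation circle := (uniform_prob (twopi_gt0 R)).
Implicit Types (p : coord_pair n) (x y : sphere) (G H : sphere -> R).

(** Both starting points are turned to the first axis of the plane and then moved
    by the same angle. *)
Lemma pair_mean_contract p x y G H (a w : R) :
  bounded_measurable G -> bounded_measurable H ->
  (forall x' y', G x' <= G y' + H y' + a * sqdist x' y' + w) ->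
  pair_mean p G x <= pair_mean p G y + pair_mean p H y + a * pair_sqdist p x y + w.
Proof.
move=> bG bH le_G.
have [x0 [Qx xi xj xk]] := pair_mean_axis p x.
have [y0 [Qy yi yj yk]] := pair_mean_axis p y.
rewrite -(Qx G)// -(Qy G)// -(Qy H)// {Qx Qy}.
pose D := radius2 p x - radius2 p y.
pose rest := \sum_(k | (k != (val p).1) && (k != (val p).2)) sqgap x y k ^+ 2.
pose q (t : R) := cos t ^+ 4 + sin t ^+ 4.
have sqE t : sqdist (turn p t x0) (turn p t y0) = rest + D ^+ 2 * q t.
  rewrite /sqdist (sum_coord_pair p) addrC; congr (_ + _).
    by apply: eq_bigr => k /andP[ki kj]; rewrite /sqgap xk ?yk.
  rewrite /sqgap xi xj yi yj !exprMn !sqr_sqrtr ?radius2_ge0// /D /q.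
  by ring.
have -> : pair_sqdist p x y = rest + D ^+ 2 * (3 / 4).
  by rewrite /pair_sqdist /sqdist (sum_coord_pair p) -/rest /D radius2B; ring.
have bq : bounded_measurable q by exact: bounded_measurable_fourth_powers.
have bGx := bounded_measurable_turn p x0 bG.
have bGy := bounded_measurable_turn p y0 bG.
have bHy := bounded_measurable_turn p y0 bH.
have bc c := @bounded_measurable_cst _ R R c.
have b1 := bounded_measurableD bGy bHy.
have b2 := bounded_measurableM (bc (a * D ^+ 2)) bq.
have b3 := bounded_measurableD b1 b2.
apply: (@le_trans _ _ (\int[circle]_t (G (turn p t y0) + H (turn p t y0) +
    a * D ^+ 2 * q t + (a * rest + w)))).
  apply: mean_le => //; first exact: (bounded_measurableD b3 (bc _)).
  by move=> t; have := le_G (turn p t x0) (turn p t y0); rewrite sqE; lra.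
have -> : \int[circle]_t (G (turn p t y0) + H (turn p t y0) +
    a * D ^+ 2 * q t + (a * rest + w)) =
    pair_mean p G y0 + pair_mean p H y0 + a * D ^+ 2 * (3 / 4) + (a * rest + w).
  apply: (etrans (meanD circle b3 (bc _))); rewrite mean_cst; congr (_ + _).
  apply: (etrans (meanD circle b1 b2)); congr (_ + _); first exact: meanD.
  by rewrite -mean_fourth_powers; exact: meanZ.
lra.
Qed.

Lemma kac_mean_contract x y G H (a w : R) : 0 <= a ->
  bounded_measurable G -> bounded_measurable H ->
  (forall x' y', G x' <= G y' + H y' + a * sqdist x' y' + w) ->
  kac_mean G x <= kac_mean G y + kac_mean H y +
    a * (1 - (2 * n%:R)^-1) * sqdist x y + w.
Proof.
move=> a0 bG bH le_G.
have C0 : 0 < 'C(n, 2)%:R :> R by exact: bin2_gt0.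
apply: (@le_trans _ _ ('C(n, 2)%:R^-1 * \sum_p (pair_mean p G y +
    pair_mean p H y + a * pair_sqdist p x y + w))).
  rewrite ler_wpM2l ?invr_ge0//; apply: ler_sum => p _.
  exact: pair_mean_contract.
rewrite !big_split/= sumr_const card_coord_pair !mulrDr -mulr_sumr.
rewrite -[w *+ _]mulr_natl mulKf ?gt_eqF//.
have := ler_wpM2l a0 (sum_pair_sqdist x y); rewrite /kac_mean; lra.
Qed.

Lemma kac_mean_iter_contract G H (a w : R) (s : nat) : 0 <= a ->
  bounded_measurable G -> bounded_measurable H ->
  (forall x, 0 <= G x) -> (forall x, 0 <= H x) ->
  (forall x y, G x <= G y + H y + a * sqdist x y + w) ->
  forall x y, iter s (@kac_mean R n n2) G x <= iter s (@kac_mean R n n2) G y +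
    iter s (@kac_mean R n n2) H y +
    a * (1 - (2 * n%:R)^-1) ^+ s * sqdist x y + w.
Proof.
move=> a0 bG bH G0 H0 le_G; elim: s => [|s IH] x y.
  by rewrite expr0 mulr1; exact: le_G.
have [bGs _] := bounded_measurable_kac_mean_iter s bG G0; have [bHs _] := bounded_measurable_kac_mean_iter s bH H0.
rewrite exprSr mulrA !iterS; apply: kac_mean_contract => //.
rewrite mulr_ge0// exprn_ge0// subr_ge0 invf_le1 ?mulr_gt0// ?ltr0n ?(ltnW n2)//.
by rewrite -natrM ler1n muln_gt0 /= ltnW.
Qed.

End proportional.

(** * Small coordinates under the uniform law *)

Section small_coordinates.
Context (R : realType) (n : nat) (n2 : (1 < n)%N).
Notation sphere := (sphere R n2).
Notation circle := (uniform_prob (twopi_gt0 R)).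
Notation tau := (2 * pi : R).
Implicit Types (p q : coord_pair n) (x y : sphere).

Lemma circle_cos_small (u : R) : 0 <= u ->
  \int[circle]_t \1_[set t : R | `|sin t| <= u] (t + pi / 2) <= 2 * u.
Proof.
move=> u0; rewrite circle_mean_shift.
- exact: circle_sin_small.
- by apply: bounded_measurable_indic; exact: measurable_sin_small.
- move=> t; rewrite !indicE; congr ((nat_of_bool _)%:R).
  by apply/idP/idP => /set_mem/= h; apply/mem_set => /=; move: h;
    rewrite (_ : tau = pi *+ 2) ?mulr_natl// sinD2pi.
- by have := pi_gt0 R; lra.
Qed.

Variable eta : R.
Hypothesis eta0 : 0 < eta.

(** A point with a small coordinate is unbalanced in the plane of this coordinate
    and one of square at least [1/n].  Rotations in that plane preserve the lower
    bound on the radius, and make the coordinate larger with high probability. *)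
Definition unbalanced q : set sphere := [set x | n%:R^-1 <= radius2 q x] `&`
  ([set x | sphere_coord (val q).1 x ^+ 2 < eta] `|`
   [set x | sphere_coord (val q).2 x ^+ 2 < eta]).

Lemma measurable_unbalanced q : measurable (unbalanced q).
Proof.
have mc k : measurable_fun [set: sphere] (fun x => sphere_coord k x ^+ 2).
  by apply: measurable_funX; exact: measurable_sphere_coord.
have ms k : measurable [set x : sphere | sphere_coord k x ^+ 2 < eta].
  rewrite (_ : [set x | _] = [set: sphere] `&` (fun x => sphere_coord k x ^+ 2) @^-1` `]-oo, eta[).
    by apply: (mc k) => //; exact: measurable_itv.
  by rewrite setTI; apply/seteqP; split => x /=; rewrite in_itv.
apply: measurableI; last exact: measurableU.
have m : measurable_fun [set: sphere] (@radius2 R n n2 q) by exact: measurable_funD.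
rewrite (_ : [set x | _] = [set: sphere] `&` @radius2 R n n2 q @^-1` `[n%:R^-1, +oo[).
  by apply: m => //; exact: measurable_itv.
by rewrite setTI; apply/seteqP; split => x /=; rewrite in_itv/= andbT.
Qed.

Lemma pair_mean_unbalanced q x :
  pair_mean q (\1_(unbalanced q)) x <= 4 * Num.sqrt (n%:R * eta).
Proof.
have n0 : 0 < n%:R :> R by rewrite ltr0n ltnW.
have bE := @bounded_measurable_indic _ _ R _ (measurable_unbalanced q).
set u := Num.sqrt _; have u0 : 0 <= u by exact: sqrtr_ge0.
have [x0 [Qx xi xj _]] := pair_mean_axis q x.
rewrite -Qx//.
have r2 t : radius2 q (turn q t x0) = radius2 q x.
  rewrite /radius2 xi xj !exprMn sqr_sqrtr ?radius2_ge0//.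
  by rewrite -mulrDr cos2Dsin2 mulr1.
pose S := [set t : R | `|sin t| <= u].
have bS := @bounded_measurable_indic _ _ R _ (measurable_sin_small u).
have bS' : bounded_measurable (fun t : R => \1_S (t + pi / 2) : R).
  by apply: (bounded_measurable_comp _ bS); exact: measurable_funD.
have small c : n%:R^-1 <= radius2 q x ->
    (Num.sqrt (radius2 q x) * c) ^+ 2 < eta -> `|c| <= u.
  move=> rx; rewrite exprMn sqr_sqrtr ?radius2_ge0// => rc.
  rewrite -(@ler_pXn2r _ 2)// ?nnegrE// sqr_sqrtr ?mulr_ge0 ?(ltW eta0)//.
  rewrite real_normK ?num_real//.
  have : n%:R^-1 * c ^+ 2 <= eta.
    by rewrite (le_trans _ (ltW rc))// ler_wpM2r ?sqr_ge0.
  by rewrite ler_pdivrMl.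
apply: (@le_trans _ _ (\int[circle]_t (\1_S t + \1_S (t + pi / 2)))).
  apply: mean_le; [exact: (bounded_measurable_turn q x0 bE)|exact: bounded_measurableD|].
  move=> t; rewrite [leLHS]indicE; case: (boolP (_ \in _)) => [/set_mem|_]; last first.
    by rewrite addr_ge0// indicE.
  move=> [/=]; rewrite r2 => rx [|]; rewrite /= ?xi ?xj => /(small _ rx) h.
    by rewrite [X in _ + X]indicE mem_set ?lerDr// ?indicE// /S/= sinDpihalf.
  by rewrite [X in X + _]indicE mem_set ?lerDl// indicE.
rewrite meanD//.
have := circle_cos_small u0; have := circle_sin_small u0.
rewrite -/S; set a := Rintegral _ _ _; set b := Rintegral _ _ _.
by clearbody a b; lra.
Qed.

Lemma near_axis_unbalanced p x : eta <= n%:R^-1 -> near_axis eta p x ->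
  exists q, unbalanced q x.
Proof.
move=> etan; rewrite /near_axis/= => px.
have n0 : 0 < n%:R :> R by rewrite ltr0n ltnW.
pose i := (val p).1.
have xi : sphere_coord i x ^+ 2 < eta.
  by rewrite (le_lt_trans _ px)// /radius2 lerDl sqr_ge0.
have [k xk] : exists k, n%:R^-1 <= sphere_coord k x ^+ 2.
  apply/not_existsP => small.
  have : \sum_(k : 'I_n) sphere_coord k x ^+ 2 < \sum_(k : 'I_n) n%:R^-1.
    apply: ltr_sum => [|k _]; last by rewrite ltNge; apply/negP/small.
    by apply/hasP; exists i; rewrite ?mem_index_enum.
  rewrite sphere_coord_sum sumr_const card_ord -[(n%:R^-1 : R) *+ n]mulr_natl divff ?gt_eqF//.
  by rewrite ltxx.
have ik : i != k.
  by apply: contraTneq xk => <-; rewrite -ltNge (lt_le_trans xi).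
case: (ltngtP i k) => [lt|lt|/val_inj ik']; last by rewrite ik' eqxx in ik.
- exists (exist _ (i, k) lt : coord_pair n); split => /=; last by left.
  by rewrite (le_trans xk)// /radius2/= lerDr sqr_ge0.
- exists (exist _ (k, i) lt : coord_pair n); split => /=; last by right.
  by rewrite (le_trans xk)// /radius2/= lerDl sqr_ge0.
Qed.

Lemma uniform_axis_risk (U : probability sphere R) : is_uniform U ->
  \int[U]_x axis_risk eta x <= 'C(n, 2)%:R * (4 * Num.sqrt (n%:R * eta)).
Proof.
move=> uU.
have n0 : 0 < n%:R :> R by rewrite ltr0n ltnW.
have C1 : 1 <= 'C(n, 2)%:R :> R by rewrite ler1n bin_gt0.
have C0 : 0 < 'C(n, 2)%:R :> R by exact: bin2_gt0.
set u := Num.sqrt _; have u0 : 0 <= u by exact: sqrtr_ge0.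
have bN p := @bounded_measurable_indic _ _ R _ (@measurable_near_axis R n n2 eta p).
have bE q := @bounded_measurable_indic _ _ R _ (measurable_unbalanced q).
have near p : \int[U]_x \1_(near_axis eta p) x <= 'C(n, 2)%:R * (4 * u).
  (* For large eta the bound exceeds 1. *)
  have [etan|etan] := leP eta n%:R^-1; last first.
    apply: (@le_trans _ _ 1).
      rewrite -[leRHS](mean_cst U); apply: mean_le => //.
      exact: bounded_measurable_cst.
    have : 1 <= u.
      rewrite -sqrtr1 ler_sqrt ?mulr_ge0 ?(ltW eta0)//.
      by rewrite -ler_pdivrMl// mulr1 ltW.
    by nra.
  apply: (@le_trans _ _ (\int[U]_x \sum_q \1_(unbalanced q) x)).
    apply: mean_le => //; first exact: bounded_measurable_sum.
    move=> x; rewrite indicE; case: (boolP (x \in _)) => [/set_mem px|_]; last first.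
      by apply: sumr_ge0 => q _; rewrite indicE.
    have [q qx] := near_axis_unbalanced etan px.
    rewrite (bigD1 q)//= [X in X + _]indicE mem_set// lerDl.
    by apply: sumr_ge0 => r _; rewrite indicE.
  rewrite mean_sum// -card_coord_pair mulr_natl -sumr_const; apply: ler_sum => q _.
  rewrite -(uniform_pair_mean uU q (bE q)) => [|x]; last by rewrite indicE.
  rewrite -[leRHS](mean_cst U); apply: mean_le.
  - by apply: bounded_measurable_pair_mean => // x; rewrite indicE.
  - exact: bounded_measurable_cst.
  - by move=> x; exact: pair_mean_unbalanced.
rewrite /axis_risk meanZ; last by apply: bounded_measurable_sum => p; exact: bN.
rewrite mean_sum//.
rewrite ler_pdivrMl// -[X in _ <= X%:R * _]card_coord_pair mulr_natl -sumr_const.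
by apply: ler_sum => p _; exact: near.
Qed.

End small_coordinates.

(** * Mixing *)

Section mixing.
Context (R : realType) (n : nat) (n2 : (1 < n)%N).
Notation sphere := (sphere R n2).
Notation K := (@kac_mean R n n2).
Implicit Types (x y : sphere).

Lemma sqdist_le2 x y : sqdist x y <= 2.
Proof.
have le1 k (z : sphere) : sphere_coord k z ^+ 2 <= 1 :> R.
  rewrite -(sphere_coord_sum z) (bigD1 k)//= lerDl.
  by apply: sumr_ge0 => l _; exact: sqr_ge0.
apply: (@le_trans _ _ (\sum_(k : 'I_n) (sphere_coord k x ^+ 2 + sphere_coord k y ^+ 2))).
  apply: ler_sum => k _; rewrite /sqgap.
  have := le1 k x; have := le1 k y.
  have := sqr_ge0 (sphere_coord k x); have := sqr_ge0 (sphere_coord k y).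
  move: (sphere_coord k x ^+ 2) (sphere_coord k y ^+ 2) => a b; nra.
by rewrite big_split/= !sphere_coord_sum -[leRHS]/(1 + 1).
Qed.

(** The coalescing coupling needs a small [gap]; when the [gap] is not small, the
    contracted quantity [sqdist] is large, and it pays for the trivial bound. *)
Lemma gap_le_or_sqdist (Delta : R) x y : 0 < Delta ->
  gap x y <= Delta \/ 1 <= n%:R ^+ 2 / Delta ^+ 2 * sqdist x y.
Proof.
move=> D0; have n0 : 0 < n%:R :> R by rewrite ltr0n ltnW.
have [|gD] := leP (gap x y) Delta; [by left|right].
have [k dk] : exists k, Delta / n%:R <= `|sqgap x y k|.
  apply/not_existsP => small.
  have : gap x y <= \sum_(k : 'I_n) Delta / n%:R.
    by apply: ler_sum => k _; rewrite leNgt; apply/negP => /ltW/small.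
  rewrite sumr_const card_ord -[(Delta / n%:R) *+ n]mulr_natl mulrC divfK ?gt_eqF//.
  by rewrite leNgt gD.
have : (Delta / n%:R) ^+ 2 <= sqdist x y.
  rewrite (@le_trans _ _ (sqgap x y k ^+ 2))//.
    by rewrite -[leRHS]real_normK ?num_real// ler_pXn2r// nnegrE divr_ge0 ?ltW.
  by rewrite /sqdist (bigD1 k)//= lerDl sumr_ge0// => l _; exact: sqr_ge0.
rewrite expr_div_n => h.
apply: (@le_trans _ _ (n%:R ^+ 2 / Delta ^+ 2 * (Delta ^+ 2 / n%:R ^+ 2))).
  by rewrite mulrA divfK ?divff// gt_eqF// exprn_gt0.
by rewrite ler_wpM2l// divr_ge0// exprn_ge0// ltW.
Qed.

Variables (U : probability sphere R) (uU : is_uniform U).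

(** [s] steps of contraction are followed by [t] steps of coalescence.  The
    coalescence bound is integrated against the uniform law, for which
    [axis_loss] is [t] times the mean of [axis_risk]. *)
Lemma kac_mean_iter_uniform (F : sphere -> R) (Delta eta : R) (s t : nat) x :
  0 < Delta -> 0 < eta -> bounded_measurable F -> (forall z, 0 <= F z <= 1) ->
  iter (s + t) K F x <= \int[U]_y F y +
    t%:R * ('C(n, 2)%:R * (4 * Num.sqrt (n%:R * eta)) + 2 * Num.sqrt (Delta / eta)) +
    2 * (n%:R ^+ 2 / Delta ^+ 2) * (1 - (2 * n%:R)^-1) ^+ s +
    2 ^+ n * (1 - 2^-1 / 'C(n, 2)%:R) ^+ t.
Proof.
move=> D0 eta0 bF F01.
have F0 z : 0 <= F z by have /andP[] := F01 z.
have F1 z : F z <= 1 by have /andP[] := F01 z.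
have [bG G0] := bounded_measurable_kac_mean_iter t bF F0.
have G1 := kac_mean_iter_le1 t bF F0 F1.
have [bL L0] := axis_loss_spec n2 eta t.
set G := iter t K F in bG G0 G1.
have n1 : 1 <= n%:R :> R by rewrite ler1n ltnW.
have C1 : 1 <= 'C(n, 2)%:R :> R by rewrite ler1n bin_gt0.
set a := n%:R ^+ 2 / Delta ^+ 2.
have a0 : 0 <= a by rewrite divr_ge0// exprn_ge0// ltW.
set rho := 1 - 2^-1 / _.
have rho0 : 0 <= rho.
  rewrite /rho subr_ge0 ler_pdivrMr ?(lt_le_trans _ C1)// mul1r (le_trans _ C1)//; lra.
set lam := 1 - (2 * n%:R)^-1.
have lam0 : 0 <= lam.
  rewrite /lam subr_ge0 invf_le1 ?mulr_gt0// ?(lt_le_trans _ n1)//.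
  by rewrite -natrM ler1n muln_gt0 /= ltnW.
pose kappa : R := t%:R * (2 * Num.sqrt (Delta / eta)).
have kappa0 : 0 <= kappa by rewrite !mulr_ge0// sqrtr_ge0.
have r0 : 0 <= 2 ^+ n * rho ^+ t by rewrite mulr_ge0// exprn_ge0.
have step u v : G u <= G v + axis_loss eta t v + a * sqdist u v +
    (kappa + 2 ^+ n * rho ^+ t).
  have S0 : 0 <= a * sqdist u v.
    by rewrite mulr_ge0// sumr_ge0// => k _; exact: sqr_ge0.
  have [le_gap|] := gap_le_or_sqdist u v D0; last first.
    rewrite -/a; have := G0 v; have := G1 u; have := L0 v; lra.
  have := kac_mean_iter_coalesce eta0 t (ltW D0) bF F01 le_gap.
  rewrite -/G -/kappa -/rho.
  have : 2 ^+ #|mismatch u v| * rho ^+ t <= 2 ^+ n * rho ^+ t.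
    rewrite ler_wpM2r ?exprn_ge0// ler_weXn2l ?ler1n//.
    by rewrite -[leqRHS]card_ord max_card.
  lra.
have H y := kac_mean_iter_contract s a0 bG bL G0 L0 step x y.
have [bGs _] := bounded_measurable_kac_mean_iter s bG G0; have [bLs _] := bounded_measurable_kac_mean_iter s bL L0.
have bc c := @bounded_measurable_cst _ sphere R c.
pose w := 2 * a * lam ^+ s + (kappa + 2 ^+ n * rho ^+ t).
have : iter (s + t) K F x <=
    \int[U]_y (iter s K G y + iter s K (axis_loss eta t) y + w).
  rewrite -[leLHS](mean_cst U); apply: mean_le => //.
    by apply: bounded_measurableD => //; exact: bounded_measurableD.
  move=> y; rewrite iterD; apply: (le_trans (H y)).
  rewrite -/lam /w -!addrA !lerD2l lerD2r mulrAC ler_wpM2r ?exprn_ge0//.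
  by rewrite mulrC ler_wpM2r// sqdist_le2.
have -> : \int[U]_y (iter s K G y + iter s K (axis_loss eta t) y + w) =
    \int[U]_y F y + t%:R * \int[U]_y axis_risk eta y + w.
  rewrite meanD//; last exact: bounded_measurableD.
  rewrite mean_cst meanD// !(uniform_kac_mean_iter uU)//.
  by rewrite uniform_axis_loss// /G (uniform_kac_mean_iter uU).
have := uniform_axis_risk eta0 uU.
set I := \int[U]_x axis_risk eta x; set J := \int[U]_x F x.
clearbody I J => leI leit.
have : t%:R * I <= t%:R * ('C(n, 2)%:R * (4 * Num.sqrt (n%:R * eta))) by rewrite ler_wpM2l.
rewrite /w /kappa in leit *; move: leit; rewrite mulrDr; lra.
Qed.

Lemma kac_law_uniform (A : set sphere) (Delta eta : R) (s t : nat) x :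
  0 < Delta -> 0 < eta -> measurable A ->
  (law \d_x (kac R n2) (s + t) A <= U A + (
    t%:R * ('C(n, 2)%:R * (4 * Num.sqrt (n%:R * eta)) + 2 * Num.sqrt (Delta / eta)) +
    2 * (n%:R ^+ 2 / Delta ^+ 2) * (1 - (2 * n%:R)^-1) ^+ s +
    2 ^+ n * (1 - 2^-1 / 'C(n, 2)%:R) ^+ t)%:E)%E.
Proof.
move=> D0 eta0 mA.
have bA := @bounded_measurable_indic _ _ R _ mA.
have A01 z : 0 <= (\1_A z : R) <= 1 by rewrite indicE; case: (_ \in _); rewrite lexx ler01.
have A0 z : 0 <= (\1_A z : R) by have /andP[] := A01 z.
rewrite -(mean_indic (law _ _ _) mA) -(mean_indic U mA) -EFinD lee_fin mean_law//.
have [bi _] := bounded_measurable_kac_mean_iter (s + t) bA A0.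
have -> : \int[\d_x]_z iter (s + t) K (\1_A) z = iter (s + t) K (\1_A) x.
  apply: EFin_inj; rewrite mean_EFin// integral_dirac//.
    by rewrite diracT mul1e.
  by apply/measurable_EFinP; case: bi.
by have := kac_mean_iter_uniform s t x D0 eta0 bA A01; rewrite !addrA.
Qed.

(** The complement of an event gives the lower bound. *)
Lemma kac_tv_dist (Delta eta : R) (s t : nat) x : 0 < Delta -> 0 < eta ->
  (tv_dist (law \d_x (kac R n2) (s + t)) U <= (2 * (
    t%:R * ('C(n, 2)%:R * (4 * Num.sqrt (n%:R * eta)) + 2 * Num.sqrt (Delta / eta)) +
    2 * (n%:R ^+ 2 / Delta ^+ 2) * (1 - (2 * n%:R)^-1) ^+ s +
    2 ^+ n * (1 - 2^-1 / 'C(n, 2)%:R) ^+ t))%:E)%E.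
Proof.
move=> D0 eta0; rewrite /tv_dist EFinM lee_wpmul2l ?lee_fin//.
apply: ge_ereal_sup => _ [A mA <-].
set P := law _ _ _.
have h B (mB : measurable B) := kac_law_uniform s t x D0 eta0 mB.
set e := (_ + _ : R) in h *.
have hA := h _ mA; have hC := h _ (measurableC mA).
rewrite -/P in hA hC.
rewrite !probability_setC// in hC.
have PA : (P A \is a fin_num)%E by exact: fin_num_measure.
have UA : (U A \is a fin_num)%E by exact: fin_num_measure.
move: hA hC; rewrite -(fineK PA) -(fineK UA).
rewrite -!EFinB -!EFinD !lee_fin => hA hC.
by rewrite ler_norml; apply/andP; split; lra.
Qed.

End mixing.

(** * Choice of the parameters *)

Section rates.
Context (R : realType).

Lemma subr1_expR (a : R) (m : nat) : a <= 1 -> (1 - a) ^+ m <= expR (- (m%:R * a)).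
Proof.
move=> a1; rewrite -mulrN expRM_natl lerXn2r// ?nnegrE ?subr_ge0 ?expR_ge0//.
exact: expR_ge1Dx.
Qed.

Lemma expR_ge_linear (Y : R) : 16 <= Y -> 2048 * Y <= expR (40 * Y).
Proof.
move=> Y16; have -> : 40 * Y = 20 * Y + 20 * Y by ring.
have := expR_ge1Dx (20 * Y); rewrite expRD.
by set E := expR _; clearbody E => h; nra.
Qed.

(** With [eta = q ^+ 2] and [Delta = q ^+ 4] the coalescence terms are of order
    [q], and the contraction term is [q ^- 8] times the contraction factor
    [expR (- (m%:R / (2 * n%:R)))]; the choice of [q] makes [q ^- 8] the inverse
    square root of that factor. *)
Lemma mixing_error_small (n m : nat) (L q : R) : (1 < n)%N -> 0 <= L ->
  2560 * n%:R ^+ 5 * (1 + L) <= m%:R ->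
  q = expR (- (m%:R / (32 * n%:R))) ->
  m%:R * ('C(n, 2)%:R * (4 * Num.sqrt (n%:R * q ^+ 2)) + 2 * Num.sqrt (q ^+ 4 / q ^+ 2)) +
  2 * (n%:R ^+ 2 / (q ^+ 4) ^+ 2) * (1 - (2 * n%:R)^-1) ^+ m +
  2 ^+ n * (1 - 2^-1 / 'C(n, 2)%:R) ^+ m <= expR (- L) / 2.
Proof.
move=> n2 L0 mL qX.
pose N : R := n%:R; rewrite -/N in mL qX *.
have N2 : 2 <= N by rewrite /N ler_nat.
have N0 : 0 < N by lra.
have N4 : 16 <= N ^+ 4.
  have h4 : 4 <= N ^+ 2 by nra.
  by rewrite (_ : N ^+ 4 = N ^+ 2 * N ^+ 2); [nra|ring].
have N24 : N ^+ 2 <= N ^+ 4 by rewrite ler_weXn2l//; lra.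
have q0 : 0 < q by rewrite qX expR_gt0.
pose X := m%:R / (32 * N) : R.
have mX : m%:R = 32 * N * X by rewrite /X mulrC divfK// mulf_neq0// gt_eqF.
have XL : L + 40 * N ^+ 4 <= X / 2.
  have : 80 * N ^+ 4 * (1 + L) <= X.
    rewrite /X ler_pdivlMr ?mulr_gt0//; apply: le_trans mL.
    by rewrite le_eqVlt; apply/orP; left; apply/eqP; ring.
  by have := mulr_ge0 (exprn_ge0 4 (ltW N0)) L0; nra.
have X0 : 0 <= X by have := exprn_ge0 4 (ltW N0); lra.
rewrite -/X in qX.
have half : X * expR (- X) <= 2 * expR (- (X / 2)).
  have -> : - X = - (X / 2) + - (X / 2) by field.
  rewrite expRD mulrA ler_pM2r ?expR_gt0//.
  rewrite expRN ler_pdivrMr ?expR_gt0//.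
  by have := expR_ge1Dx (X / 2); lra.
pose E := expR (- (X / 2)).
have E0 : 0 < E by exact: expR_gt0.
have C0 : 0 < 'C(n, 2)%:R :> R by rewrite ltr0n bin_gt0.
have CN : 2 * 'C(n, 2)%:R <= N ^+ 2.
  have := congr1 (fun k : nat => k%:R : R) (mul_bin_left n 1).
  rewrite bin1 !natrM natrB ?(ltnW n2)// -/N => E1.
  by have : 2 * 'C(n, 2)%:R = (N - 1) * N := E1; nra.
have EL : 2048 * N ^+ 4 * E <= expR (- L).
  have := expR_ge_linear N4 => h.
  have : E <= expR (- L) * expR (- (40 * N ^+ 4)).
    by rewrite -expRD ler_expR; lra.
  rewrite [expR (- (40 * _))]expRN => h2.
  apply: (@le_trans _ _ (expR (40 * N ^+ 4) * E)); first by rewrite ler_wpM2r// ltW.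
  by rewrite mulrC -ler_pdivlMr ?expR_gt0.
have term1 : m%:R * ('C(n, 2)%:R * (4 * Num.sqrt (N * q ^+ 2)) +
    2 * Num.sqrt (q ^+ 4 / q ^+ 2)) <= 256 * N ^+ 4 * E.
  have -> : q ^+ 4 / q ^+ 2 = q ^+ 2 by field; rewrite gt_eqF.
  have -> : Num.sqrt (q ^+ 2) = q by rewrite sqrtr_sqr gtr0_norm.
  have sN : Num.sqrt (N * q ^+ 2) <= N * q.
    rewrite sqrtrM ?(ltW N0)// sqrtr_sqr gtr0_norm// ler_pM2r//.
    rewrite -[leRHS](gtr0_norm N0) -sqrtr_sqr ler_wsqrtr//; nra.
  apply: (@le_trans _ _ (m%:R * (4 * N ^+ 3 * q))).
    rewrite ler_wpM2l//.
    have : 'C(n, 2)%:R * (4 * Num.sqrt (N * q ^+ 2)) <= 2 * N ^+ 3 * q.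
      apply: (@le_trans _ _ ('C(n, 2)%:R * (4 * (N * q)))).
        by apply: ler_wpM2l; [exact: ltW|apply: ler_wpM2l].
      have -> : 2 * N ^+ 3 * q = 2 * (N ^+ 2 * (N * q)) by ring.
      have : 0 <= N * q by rewrite mulr_ge0// ltW.
      by move: (N * q) => z; nra.
    have : 2 * q <= 2 * N ^+ 3 * q.
      rewrite ler_pM2r// ler_pMr// exprn_ege1//; lra.
    lra.
  rewrite mX qX.
  have -> : 32 * N * X * (4 * N ^+ 3 * expR (- X)) = 128 * N ^+ 4 * (X * expR (- X)) by ring.
  have -> : 256 * N ^+ 4 * E = 128 * N ^+ 4 * (2 * E) by ring.
  by rewrite ler_wpM2l// mulr_ge0// exprn_ge0// ltW.
have term2 : 2 * (N ^+ 2 / (q ^+ 4) ^+ 2) * (1 - (2 * N)^-1) ^+ m <= 2 * N ^+ 4 * E.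
  have : (1 - (2 * N)^-1) ^+ m <= expR (- (m%:R * (2 * N)^-1)).
    by apply: subr1_expR; rewrite invf_le1; lra.
  have -> : m%:R * (2 * N)^-1 = 16 * X by rewrite mX; field; rewrite gt_eqF.
  move=> h.
  have q8 : (q ^+ 4) ^+ 2 = expR (- (8 * X)).
    by rewrite -exprM qX -expRM_natl; congr expR; ring.
  rewrite q8.
  apply: (@le_trans _ _ (2 * (N ^+ 2 / expR (- (8 * X))) * expR (- (16 * X)))).
    by rewrite ler_wpM2l// mulr_ge0// divr_ge0 ?expR_ge0// exprn_ge0// ltW.
  rewrite -expRN opprK.
  have -> : 2 * (N ^+ 2 * expR (8 * X)) * expR (- (16 * X)) =
      (2 * N ^+ 2) * expR (8 * X - 16 * X) by rewrite expRD; ring.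
  apply: ler_pM; rewrite ?expR_ge0//.
  - by rewrite mulr_ge0// exprn_ge0// ltW.
  - by rewrite ler_pM2l.
  - by rewrite ler_expR; lra.
pose b : R := 2^-1 / 'C(n, 2)%:R.
have b1 : b <= 1.
  rewrite /b ler_pdivrMr// mul1r.
  have : 1 <= 'C(n, 2)%:R :> R by rewrite ler1n bin_gt0.
  lra.
have term3 : 2 ^+ n * (1 - b) ^+ m <= expR (- L) / 8.
  have h := subr1_expR m b1.
  have two : 2 <= expR 1 :> R by have := expR_ge1Dx (1 : R); lra.
  have h2 : 2 ^+ n <= expR N :> R.
    rewrite -[N]mulr1 expRM_natl lerXn2r ?nnegrE ?expR_ge0//.
  have mC : L + N + 3 <= m%:R * b.
    have : m%:R / N ^+ 2 <= m%:R * b.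
      rewrite ler_wpM2l// /b -invfM lef_pV2 ?posrE ?exprn_gt0 ?mulr_gt0//.
    apply: le_trans; rewrite ler_pdivlMr ?exprn_gt0//; apply: le_trans mL.
    have -> : 2560 * N ^+ 5 * (1 + L) = 2560 * N ^+ 3 * (1 + L) * N ^+ 2 by ring.
    rewrite ler_pM2r ?exprn_gt0//.
    have N3 : N <= N ^+ 3 by rewrite -{1}[N]expr1 ler_weXn2l//; lra.
    nra.
  apply: (@le_trans _ _ (expR N * expR (- (L + N + 3)))).
    apply: ler_pM => //.
      by rewrite exprn_ge0// subr_ge0.
    by rewrite (le_trans h)// ler_expR lerN2.
  rewrite -expRD (_ : N + - (L + N + 3) = - L + - 3); last by ring.
  rewrite expRD ler_pM2l ?expR_gt0// expRN lef_pV2 ?posrE ?expR_gt0//.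
  have -> : (3 : R) = 1 + 1 + 1 by ring.
  by rewrite !expRD; nra.
have : 0 <= N ^+ 4 * E by rewrite mulr_ge0// ?exprn_ge0// ltW.
rewrite -/N -/b.
move: EL term1 term2 term3; rewrite -!mulrA.
lra.
Qed.

End rates.

(** Half of the time is given to each phase. *)
Lemma kac_tv_dist_half (R : realType) (n : nat) (n2 : (1 < n)%N)
    (U : probability (sphere R n2) R) (L : R) (t : nat) (x : sphere R n2) :
  is_uniform U -> 0 <= L -> 2560 * n%:R ^+ 5 * (1 + L) <= (t./2)%:R ->
  (tv_dist (law \d_x (kac R n2) t) U <= (expR (- L))%:E)%E.
Proof.
move=> uU L0 mL.
set m := t./2 in mL *.
have m_le_t : (m <= t)%N by rewrite /m -divn2 leq_div.
have mt : (m <= t - m)%N.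
  by rewrite leq_subRL// addnn -[leqRHS]odd_double_half leq_addl.
pose q := expR (- (m%:R / (32 * n%:R))) : R.
have q0 : 0 < q by exact: expR_gt0.
have n1 : 1 <= n%:R :> R by rewrite ler1n ltnW.
have err := mixing_error_small n2 L0 mL (erefl q).
have := kac_tv_dist uU (t - m) m x (exprn_gt0 4 q0) (exprn_gt0 2 q0).
rewrite subnK//.
move=> /le_trans; apply; rewrite lee_fin.
have lam : (1 - (2 * n%:R)^-1 : R) ^+ (t - m) <= (1 - (2 * n%:R)^-1) ^+ m.
  have inv1 : (2 * n%:R)^-1 <= 1 :> R by rewrite invf_le1; lra.
  have inv0 : 0 <= (2 * n%:R)^-1 :> R by rewrite invr_ge0; lra.
  by rewrite ler_wiXn2l//; lra.
have a0 : 0 <= 2 * (n%:R ^+ 2 / (q ^+ 4) ^+ 2) :> R.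
  by rewrite mulr_ge0// divr_ge0// !exprn_ge0// ltW.
have := ler_wpM2l a0 lam.
move: err; lra.
Qed.

Lemma ln2_ge (R : realType) : 1 / 2 <= ln 2 :> R.
Proof.
rewrite -[leLHS](@expRK R) ler_ln ?posrE ?expR_gt0//.
rewrite -[1 / 2]opprK expRN -[leRHS]invrK lef_pV2 ?posrE ?invr_gt0 ?expR_gt0//.
by apply: le_trans (expR_ge1Dx _); lra.
Qed.

Unset Implicit Arguments.

Theorem theorem1p1 (R : realType) (eps0 : R) (eps0_gt0 : 0 < eps0)
    (eps0_lt1 : eps0 < 1) :
  exists c : R, 0 < c /\
    forall (n : nat) (n2 : (1 < n)%N) (U : probability (sphere R n2) R),
      is_uniform U ->
      forall (eps : R) (t : nat), 0 < eps -> eps <= eps0 ->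
        c * n%:R ^+ 5 * ln n%:R ^+ 3 * ln eps^-1 < t%:R ->
        (tv_dist (law \d_(e1 R n2) (kac R n2) t) U <= eps%:E)%E.
Proof.
pose l : R := ln eps0^-1.
have l0 : 0 < l by rewrite /l ln_gt0// invf_gt1.
(* Since ln n >= 1/2, the factor (ln n)^3 costs at most 8, and t / 2 exceeds
   5125 / 2 times n^5 (1 + L) up to rounding.  The constant must absorb the 1
   in 1 + L, whence l^-1 below: L >= l. *)
have [K KE K0] : exists2 K : R, K = 41 * 1000 & 0 < K.
  exists (41 * 1000); first reflexivity.
  by apply: mulr_gt0; apply: ltr0Sn.
exists (K * (1 + l^-1)); split.
  by rewrite mulr_gt0// addr_gt0// invr_gt0.
move=> n n2 U uU eps t eps_gt0 eps_le ht.
pose L : R := ln eps^-1.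
have lL : l <= L by rewrite /L ler_ln ?posrE ?invr_gt0// lef_pV2.
have L0 : 0 < L by exact: lt_le_trans lL.
have epsE : eps = expR (- L) by rewrite /L lnV ?posrE// opprK lnK// posrE.
rewrite epsE; apply: kac_tv_dist_half => //; first exact: ltW.
have n2' : 2 <= n%:R :> R by rewrite ler_nat.
have N1 : 1 <= n%:R ^+ 5 :> R by rewrite exprn_ege1//; lra.
have ln_n : 1 / 8 <= ln n%:R ^+ 3 :> R.
  have h : 1 / 2 <= ln n%:R :> R.
    by apply: le_trans (ln2_ge R) _; rewrite ler_ln ?posrE//; lra.
  have -> : 1 / 8 = (1 / 2) ^+ 3 :> R by field.
  by rewrite lerXn2r ?nnegrE//; lra.
have cL : K * (1 + L) <= K * (1 + l^-1) * L.
  have : 1 <= l^-1 * L by rewrite mulrC ler_pdivlMr// mul1r.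
  by rewrite -mulrA ler_pM2l//; lra.
have t_big : 5125 * n%:R ^+ 5 * (1 + L) <= t%:R.
  apply: le_trans (ltW ht); rewrite -/L.
  have -> : K * (1 + l^-1) * n%:R ^+ 5 * ln n%:R ^+ 3 * L =
    (K * (1 + l^-1) * L) * n%:R ^+ 5 * ln n%:R ^+ 3 by ring.
  have -> : 5125 * n%:R ^+ 5 * (1 + L) = K * (1 + L) * n%:R ^+ 5 * (1 / 8).
    by rewrite KE; field.
  apply: ler_pM => //.
  - by rewrite !mulr_ge0 ?(ltW K0)//; lra.
  - by rewrite ler_wpM2r//; lra.
have tE : t%:R <= 2 * (t./2)%:R + 1 :> R.
  rewrite -[in leLHS](odd_double_half t) natrD -mul2n natrM addrC lerD2l.
  by case: (odd t).
have : 1 <= n%:R ^+ 5 * (1 + L) by rewrite mulr_ege1//; lra.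
move: t_big; rewrite -!mulrA; move: (n%:R ^+ 5 * (1 + L)) => z; lra.
Qed.
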